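(* Let $P$ be a hull configuration of $n$ points whose convex hull $\textsc{Conv}(P)$ is a (two-dimensional) convex polygon, and suppose that $\textsc{Conv}(P)$ has at least one blank side. Then the lattice $\textsc{NC}(P)$ of noncrossing partitions of $P$ has a symmetric chain decomposition.
   Context: A configuration is a finite set $P$ of $n$ distinct points in the plane $\mathbb{C}\cong\mathbb{R}^2$. $P$ is a hull configuration if either $\textsc{Conv}(P)$ is one-dimensional (all points lie on a line segment) or no point of $P$ lies in the interior of $\textsc{Conv}(P)$ (all points lie on the boundary of the convex polygon $\textsc{Conv}(P)$). When $\textsc{Conv}(P)$ is a polygon, a side (edge) of $\textsc{Conv}(P)$ is called blank if it contains no points of $P$ other than its two endpoints. A set partition of $P$ is noncrossing if the convex hulls of its blocks are pairwise disjoint; $\textsc{NC}(P)$ is the set of noncrossing partitions of $P$ ordered by refinement (finer is smaller). For hull configurations $\textsc{NC}(P)$ is graded with rank function $\operatorname{rk}(\pi)=n-(\text{number of blocks of }\pi)$, so ranks range over $0,\dots,n-1$. A chain $\pi_1<\cdots<\pi_m$ is saturated if each $\pi_i<\pi_{i+1}$ is a covering relation. A symmetric chain decomposition of $\textsc{NC}(P)$ is a partition of $\textsc{NC}(P)$ into saturated chains each of which is centered, i.e. symmetric about the middle rank: a chain whose minimum has rank $r$ and maximum has rank $s$ satisfies $r+s=n-1$. *)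

(* Defs.v *)
From HB Require Import structures.
From mathcomp Require Import all_boot all_order all_algebra finmap.
From mathcomp Require Import boolp classical_sets reals topology normedtype.
From mathcomp Require Import convex.

Set Implicit Arguments.
Unset Strict Implicit.
Unset Printing Implicit Defensive.

Import Order.TTheory GRing.Theory Num.Theory.
Import numFieldNormedType.Exports.

Local Open Scope classical_set_scope.
Local Open Scope ring_scope.

Section PlaneGeometry.
Variable R : realType.
Local Notation plane := 'rV[R]_2.
Implicit Types (A K : set plane) (p q u x : plane).

Definition Conv A : set plane := smallest (@convex_set R plane) A.

Definition dot u x : R := \sum_(i < 2) u 0 i * x 0 i.

Definition line u (c : R) : set plane := [set x | dot u x = c].

Definition in_line A : Prop := exists u c, u != 0 /\ A `<=` line u c.

Definition segment p q : set plane :=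
  [set (1 - t) *: p + t *: q | t in [set t : R | 0 <= t <= 1]].

(* A side is a one-dimensional face: the intersection of K with a supporting
   line, when it is a nondegenerate segment; p and q are its endpoints. *)
Definition is_side K p q : Prop :=
  p != q /\ exists u c,
    [/\ u != 0, K `<=` [set x | dot u x <= c] & K `&` line u c = segment p q].

End PlaneGeometry.

Section Configurations.
Variables (R : realType) (P : {fset 'rV[R]_2}).

Definition hull_configuration : Prop :=
  in_line (Conv [set` P]) \/
  forall x, x \in P -> ~ interior (Conv [set` P]) x.

Definition hull_is_polygon : Prop := ~ in_line (Conv [set` P]).

Definition blank_side (p q : 'rV[R]_2) : Prop :=
  is_side (Conv [set` P]) p q /\
  forall x, x \in P -> segment p q x -> x = p \/ x = q.

Definition block_hull (B : {set P}) : set 'rV[R]_2 :=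
  Conv [set x | exists2 y : P, y \in B & x = val y].

Definition noncrossing (pi : {set {set P}}) : Prop :=
  forall B C, B \in pi -> C \in pi -> B != C ->
  block_hull B `&` block_hull C = set0.

Definition is_ncpart (pi : {set {set P}}) : bool :=
  finset.partition pi [set: P]%SET && `[< noncrossing pi >].

Record NC := NCPart { ncval :> {set {set P}}; _ : is_ncpart ncval }.

HB.instance Definition _ := [isSub for ncval].
HB.instance Definition _ := [Finite of NC by <:].

Definition refines (pi sigma : NC) : bool :=
  [forall B in ncval pi, exists C in ncval sigma, B \subset C].

Definition nc_rank (pi : NC) : nat := (#|` P| - #|ncval pi|)%N.

Lemma refines_refl : reflexive refines.
Proof.
by move=> pi; apply/forall_inP => B Bpi; apply/exists_inP; exists B.
Qed.

Lemma refines_trans : transitive refines.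
Proof.
move=> s p t /forall_inP ps /forall_inP st; apply/forall_inP => B /ps.
move=> /exists_inP[C /st/exists_inP[E Et CE] BC].
by apply/exists_inP; exists E => //; apply: fintype.subset_trans CE.
Qed.

Lemma refines_anti : antisymmetric refines.
Proof.
have sub (p s : NC) : refines p s -> refines s p -> ncval p \subset ncval s.
  move=> /forall_inP ps /forall_inP sp; apply/fintype.subsetP => B Bp.
  have /exists_inP[C Cs BC] := ps _ Bp.
  have /exists_inP[B' B'p CB'] := sp _ Cs.
  case: p {ps sp} Bp B'p => p /=/andP[/and3P[_ /finset.trivIsetP tr n0] _] Bp B'p.
  have [x xB] : exists x, x \in B.
    by apply/set0Pn; apply: contraNneq n0 => <-.
  have EB : B = B'.
    apply/eqP/negPn/negP => /(tr _ _ Bp B'p)/pred0P/(_ x)/=.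
    by rewrite xB (fintype.subsetP CB') // (fintype.subsetP BC).
  by rewrite (_ : B = C) //; apply/eqP; rewrite finset.eqEsubset BC EB.
move=> p s /andP[ps sp]; apply/val_inj/eqP.
by rewrite finset.eqEsubset !sub.
Qed.

Fact nc_display : Order.disp_t. Proof. exact: (Order.Disp tt tt). Qed.

HB.instance Definition _ := Order.Le_isPOrder.Build nc_display NC
  refines_refl refines_anti refines_trans.

End Configurations.

Section SymmetricChains.
Variables (d : Order.disp_t) (T : finPOrderType d) (rk : T -> nat) (m : nat).

Definition covers : rel T := fun x y =>
  (x < y)%O && [forall z, ~~ ((x < z)%O && (z < y)%O)].

(* The chain x :: s has minimum x and maximum last x s; m is the top rank. *)
Definition symmetric_chain (C : {set T}) : Prop :=
  exists x s, [/\ C = [set z in x :: s]%SET, path covers x s &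
                  (rk x + rk (last x s))%N = m].

Definition symmetric_chain_decomposition (D : {set {set T}}) : Prop :=
  finset.partition D [set: T]%SET /\ forall C, C \in D -> symmetric_chain C.

End SymmetricChains.

(* Main.v *)
Require Import Defs.
From HB Require Import structures.
From mathcomp Require Import all_boot zify.

Set Implicit Arguments.
Unset Strict Implicit.
Unset Printing Implicit Defensive.

(* Idea. Let [p q] be the blank side. Seen from a point inside this side, the
   points of [P] appear in a linear order from [p] to [q]; since no point is
   interior to the hull, they form a convex arc, and two blocks have
   intersecting hulls iff they contain an alternating quadruple, or a triple
   [a < x < b] of collinear points with [a], [b] in one block and [x] in the
   other. For such combinatorial noncrossing partitions of an ordered set [A]
   with minimum [lo], classify by the successor [i] of [lo] in its block, as
   Simion and Ullman do for convex position. Those where [lo] is a singleton or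
   is joined to the next point form NC(A - lo) times a two-element chain; every
   other fibre is empty (if the chord from [lo] to [i] contains a point of [P]) or
   is NC(]lo, i[) x NC([i, max]). Both kinds are centred at the middle rank,
   and products of symmetric chains decompose into symmetric chains. *)

(** * Symmetric chains *)

(** Chains are measured by the number of blocks, which adds up when partitions of disjoint pieces
    are put together; a chain of partitions of [A] is centred iff the block numbers at its ends sum
    to [#|A| + 1]. Since [lo] belongs to neither factor of a fibre, the centres [#|A1| + 1] and
    [#|A2| + 1] add up to [#|A| + 1]. The obstacle is that pieces of the arc need not span polygons:
    they may be collinear or empty. The recursion therefore runs over subsets of an ordered set with
    an abstract collinearity predicate, for which two inheritance rules of a convex arc suffice. The
    empty piece breaks the count (no block, sum 0 and not 1), so the successor next to [lo] is
    treated apart, together with the singleton case. The blank side is where the boundary is cut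
    open: all other points lie strictly on one side of its line, so that of three collinear points
    the middle one in the order lies between the other two. *)

Section SymmetricChainLists.
Variables (Z : eqType) (e : rel Z) (rk : Z -> nat).

(** Only the sum of the two end ranks is recorded, so the rank may as well decrease along the chain,
    as the number of blocks does. *)
Definition schain (m : nat) (c : seq Z) : bool :=
  if c is x :: s then path e x s && (rk x + rk (last x s) == m) else false.

Definition scd (Q : pred Z) (m : nat) : Prop :=
  exists cs : seq (seq Z),
    [/\ uniq (flatten cs), flatten cs =i Q & all (schain m) cs].

Lemma eq_scd (Q Q' : pred Z) m : Q =1 Q' -> scd Q m -> scd Q' m.
Proof.
move=> QQ' [cs [ucs csQ csm]]; exists cs; split=> // z.
by rewrite csQ -!topredE /= QQ'.
Qed.

Lemma scd0 m : scd pred0 m.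
Proof. by exists [::]; split. Qed.

Lemma scd1 z : scd (pred1 z) (rk z + rk z).
Proof.
by exists [:: [:: z]]; split=> //= [x|]; rewrite ?inE ?eqxx.
Qed.

Lemma scdU (Q1 Q2 : pred Z) m : (forall z, Q1 z -> ~~ Q2 z) ->
  scd Q1 m -> scd Q2 m -> scd (predU Q1 Q2) m.
Proof.
move=> dis [cs1 [u1 m1 c1]] [cs2 [u2 m2 c2]]; exists (cs1 ++ cs2).
split; last by rewrite all_cat c1.
- rewrite flatten_cat cat_uniq u1 u2 andbT /=.
  by apply/hasPn => z; rewrite m2 m1; apply/contraL/dis.
- by move=> z; rewrite flatten_cat mem_cat m1 m2.
Qed.

Lemma scd_fibers (I : finType) (h : Z -> I) (Q : pred Z) m :
  (forall i, scd [pred z | Q z && (h z == i)] m) -> scd Q m.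
Proof.
move=> scdi.
suff scds s : uniq s -> scd [pred z | Q z && (h z \in s)] m.
  apply: eq_scd (scds _ (enum_uniq I)) => z /=.
  by rewrite mem_enum andbT.
elim: s => [_|i s IHs /= /andP[nis us]].
  by apply: eq_scd (scd0 m) => z /=; rewrite andbF.
apply: eq_scd (scdU _ (scdi i) (IHs us)) => z /=.
  by rewrite inE andb_orr.
by case/andP=> _ /eqP->; rewrite negb_and nis orbT.
Qed.

End SymmetricChainLists.

(** * Products of symmetric chain decompositions *)

Section ProductOfChains.
Variables (X Y Z : eqType) (eX : rel X) (eY : rel Y) (eZ : rel Z).
Variables (rkX : X -> nat) (rkY : Y -> nat) (rkZ : Z -> nat).
Variables (f : X -> Y -> Z) (QX : pred X) (QY : pred Y).
Hypothesis eX_rk : forall x x', eX x x' -> rkX x = (rkX x').+1.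
Hypothesis eY_rk : forall y y', eY y y' -> rkY y = (rkY y').+1.
Hypothesis f_homol : forall x x' y, QX x -> QX x' -> QY y ->
  eX x x' -> eZ (f x y) (f x' y).
Hypothesis f_homor : forall x y y', QX x -> QY y -> QY y' ->
  eY y y' -> eZ (f x y) (f x y').
Hypothesis f_rk : forall x y, QX x -> QY y -> rkZ (f x y) = rkX x + rkY y.
Hypothesis f_inj : forall x x' y y', QX x -> QX x' -> QY y -> QY y' ->
  f x y = f x' y' -> x = x' /\ y = y'.

(* The grid is peeled off in hooks: the bottom row followed by the last column,
   which leaves a grid with one row and one column less and the same centre. *)
Lemma grid_schains ys xs mx my :
  all QX xs -> all QY ys -> schain eX rkX mx xs -> schain eY rkY my ys ->
  exists zs, perm_eq (flatten zs) [seq f x y | x <- xs, y <- ys] /\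
    all (schain eZ rkZ (mx + my)) zs.
Proof.
elim: ys xs mx my => // y ys IH [//|x s] mx my Qxs Qys Hx Hy.
pose hook := [seq f z y | z <- x :: s] ++ [seq f (last x s) w | w <- ys].
have Qx : QX x by case/andP: Qxs.
have Qy : QY y by case/andP: Qys.
have Qs z : z \in x :: s -> QX z by move/allP: Qxs; apply.
have Qt z : z \in y :: ys -> QY z by move/allP: Qys; apply.
have Ql : QX (last x s) by apply/Qs/mem_last.
have Qm : QY (last y ys) by apply/Qt/mem_last.
move: Hx Hy => /= /andP[px /eqP ex] /andP[py /eqP ey].
have hookP : schain eZ rkZ (mx + my) hook.
  rewrite /= last_cat cat_path -!andbA; apply/and3P; split.
  - apply: (homo_path_in (P := QX)) Qxs px => a b Qa Qb.
    exact: f_homol.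
  - rewrite last_map.
    apply: (homo_path_in (P := QY)) Qys py => a b Qa Qb.
    exact: f_homor.
  - rewrite last_map last_map !f_rk //; apply/eqP; lia.
have perm_hook : perm_eq [seq f a b | a <- x :: s, b <- y :: ys]
    (hook ++ [seq f a b | a <- belast x s, b <- ys]).
  rewrite perm_allpairs_consr -catA perm_cat2l lastI allpairs_rcons.
  by rewrite perm_catC.
have [bel0|] := eqVneq [seq f a b | a <- belast x s, b <- ys] [::].
  exists [:: hook]; split; last by apply/andP.
  by rewrite perm_sym; move: perm_hook; rewrite bel0.
case/lastP: s @hook px ex Qxs Qs Ql hookP perm_hook => //.
move=> s x1 hook px ex Qxs Qs Ql hookP perm_hook.
rewrite belast_rcons => bel_neq0.
case: ys IH py ey Qys Qt Qm @hook hookP bel_neq0 perm_hook.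
  by move=> _ _ _ _ _ _ hook _ /negP[]; elim: (x :: s).
move=> y1 ys IH py ey Qys Qt Qm hook hookP _ perm_hook.
(* Ranks decrease along both chains: dropping the last element of the first raises its end rank by
   one, dropping [y] lowers the starting rank of the second by one, so the sum of the centres is
   kept. *)
have [|||| zs [pzs czs]] := IH (x :: s) mx.+1 my.-1.
- by apply/allP => z zs; apply: Qs; rewrite -rcons_cons mem_rcons inE zs orbT.
- by case/andP: Qys.
- move: px; rewrite rcons_path /= => /andP[-> /eX_rk].
  by rewrite -ex last_rcons => -> /=; apply/eqP; lia.
- move: py ey => /= /andP[/eY_rk-> ->] /=; lia.
exists (hook :: zs); split.
  rewrite perm_sym; apply: perm_trans perm_hook _.
  by rewrite belast_rcons perm_cat2l perm_sym.
apply/andP; split=> //; move: py ey => /= /andP[/eY_rk yy1 _] ey.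
by move: czs; rewrite (_ : mx.+1 + my.-1 = mx + my) //; lia.
Qed.

Lemma scd_product (QZ : pred Z) mx my :
  scd eX rkX QX mx -> scd eY rkY QY my ->
  (forall z, reflect (exists x y, [/\ QX x, QY y & z = f x y]) (QZ z)) ->
  scd eZ rkZ QZ (mx + my).
Proof.
move=> [cs [ucs csQ csm]] [ds [uds dsQ dsm]] QZP.
have grids : exists zs,
    perm_eq (flatten zs) [seq f x y | x <- flatten cs, y <- flatten ds] /\
    all (schain eZ rkZ (mx + my)) zs.
  have: all QX (flatten cs) by apply/allP=> x; rewrite csQ.
  have: all QY (flatten ds) by apply/allP=> x; rewrite dsQ.
  elim: cs csm {ucs csQ} => [_ _ _|c cs IHc /= /andP[cm csm] ad].
    by exists [::].
  rewrite all_cat => /andP[ac acs].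
  have [zs [pzs zsm]] := IHc csm ad acs.
  suff [zs' [pzs' zsm']] : exists zs,
      perm_eq (flatten zs) [seq f x y | x <- c, y <- flatten ds] /\
      all (schain eZ rkZ (mx + my)) zs.
    exists (zs' ++ zs); rewrite all_cat zsm zsm' flatten_cat allpairs_cat.
    by split=> //; apply: perm_cat.
  elim: ds dsm ad {IHc uds dsQ zs pzs zsm} => [_ _|d ds IHd].
    by exists [::]; split=> //=; elim: (c).
  move=> /= /andP[dm dsm]; rewrite all_cat => /andP[ad ads].
  have [zs [pzs zsm]] := IHd dsm ads.
  have [zs' [pzs' zsm']] := grid_schains ac ad cm dm.
  exists (zs' ++ zs); rewrite all_cat zsm zsm' flatten_cat; split=> //.
  by apply: perm_trans (perm_cat pzs' pzs) _; rewrite perm_sym perm_allpairs_catr.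
have [zs [pzs zsm]] := grids; exists zs; split=> //.
- rewrite (perm_uniq pzs); apply: allpairs_uniq => // -[x y] [x' y'] /=.
  move=> /allpairsP[[a b] /= [aQ bQ [-> ->]]].
  move=> /allpairsP[[a' b'] /= [a'Q b'Q [-> ->]]].
  rewrite !csQ !dsQ in aQ a'Q bQ b'Q.
  by case/(f_inj aQ a'Q bQ b'Q) => -> ->.
- move=> z; rewrite (perm_mem pzs) -[RHS]topredE /=; apply/allpairsP/QZP.
    by case=> -[x y] /= []; rewrite csQ dsQ => Qx Qy ->; exists x, y.
  by case=> x [y [Qx Qy ->]]; exists (x, y); rewrite csQ dsQ.
Qed.

End ProductOfChains.

(** * Noncrossing partitions of an ordered set *)

Section Refinement.
Variable T : finType.
Implicit Types (A B C : {set T}) (pi sigma rho : {set {set T}}).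

Definition refine pi sigma : bool :=
  [forall B in pi, exists C in sigma, B \subset C].

Lemma refineP pi sigma :
  reflect (forall B, B \in pi -> exists2 C, C \in sigma & B \subset C)
          (refine pi sigma).
Proof.
apply: (iffP forall_inP) => H B /H; first by case/exists_inP=> C; exists C.
by case=> C Cs BC; apply/exists_inP; exists C.
Qed.

Lemma refinexx pi : refine pi pi.
Proof. by apply/refineP => B; exists B. Qed.

Lemma refineU pi pi' sigma sigma' :
  refine pi pi' -> refine sigma sigma' ->
  refine (pi :|: sigma) (pi' :|: sigma').
Proof.
move=> /refineP p /refineP s; apply/refineP => B /setUP[/p|/s] [C C1 BC];
by exists C; rewrite // inE C1 ?orbT.
Qed.

Lemma refine_imset (g : {set T} -> {set T}) pi sigma :
  (forall B C, B \subset C -> g B \subset g C) ->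
  refine pi sigma -> refine (g @: pi) (g @: sigma).
Proof.
move=> gS /refineP ps; apply/refineP => _ /imsetP[B /ps[C Cs BC] ->].
by exists (g C); [apply: imset_f|apply: gS].
Qed.

Lemma partition_block_eq A pi B C x :
  partition pi A -> B \in pi -> C \in pi -> x \in B -> x \in C -> B = C.
Proof.
move=> /and3P[_ tI _] Bp Cp xB xC.
by rewrite -(def_pblock tI Bp xB) (def_pblock tI Cp xC).
Qed.

Lemma partition_blockE A pi x :
  partition pi A -> x \in A -> exists2 B, B \in pi & x \in B.
Proof.
by case/and3P=> /eqP <- _ _ /bigcupP[B Bp xB]; exists B.
Qed.

Lemma partition_block_sub A pi B : partition pi A -> B \in pi -> B \subset A.
Proof. by case/and3P=> /eqP <- _ _; apply: bigcup_sup. Qed.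

Lemma partition_block_neq0 A pi B :
  partition pi A -> B \in pi -> exists x, x \in B.
Proof. by case/and3P=> _ _ p0 Bp; apply/set0Pn; apply: contraNneq p0 => <-. Qed.

Lemma partitionI A pi :
  (forall x, x \in A -> exists2 B, B \in pi & x \in B) ->
  (forall B, B \in pi -> B \subset A) ->
  (forall B, B \in pi -> exists x, x \in B) ->
  (forall B C x, B \in pi -> C \in pi -> x \in B -> x \in C -> B = C) ->
  partition pi A.
Proof.
move=> cov sub ne dis; apply/and3P; split.
- rewrite eqEsubset; apply/andP; split; first by apply/bigcupsP.
  by apply/subsetP => x /cov[B Bp xB]; apply/bigcupP; exists B.
- apply/trivIsetP => B C Bp Cp; apply: contraNT => /pred0Pn[x /andP[/= xB xC]].
  by apply/eqP; apply: dis Bp Cp xB xC.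
- by apply/negP => /ne[x]; rewrite inE.
Qed.

(** Sending each block of [pi] to the block of [sigma] around it is onto, hence injective by the
    count; so no block of [sigma] contains points of two blocks of [pi]. *)
Lemma refine_card A pi sigma : partition pi A -> partition sigma A ->
  refine pi sigma -> #|pi| <= #|sigma| -> pi = sigma.
Proof.
move=> pA sA /refineP ps le_ps.
pose h B := odflt set0 [pick C in sigma | B \subset C].
have hP B : B \in pi -> h B \in sigma /\ B \subset h B.
  by move=> /ps[C Cs BC]; rewrite /h; case: pickP => [D /andP[]|/(_ C)/andP[]].
have h_onto C x B : C \in sigma -> x \in C -> B \in pi -> x \in B -> h B = C.
  move=> Cs xC Bp xB; have [hs Bh] := hP B Bp.
  exact: partition_block_eq sA hs Cs (subsetP Bh _ xB) xC.
have sub_h : sigma \subset h @: pi.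
  apply/subsetP => C Cs; have [x xC] := partition_block_neq0 sA Cs.
  have xA := subsetP (partition_block_sub sA Cs) _ xC.
  have [B Bp xB] := partition_blockE pA xA.
  by apply/imsetP; exists B => //; rewrite (h_onto C x).
have /imset_injP h_inj : #|h @: pi| == #|pi|.
  rewrite eqn_leq leq_imset_card /=.
  exact: leq_trans le_ps (subset_leq_card sub_h).
have h_id B : B \in pi -> h B = B.
  move=> Bp; have [hs Bh] := hP B Bp; apply/eqP; rewrite eqEsubset Bh andbT.
  apply/subsetP => y yh; have yA := subsetP (partition_block_sub sA hs) _ yh.
  have [B' B'p yB'] := partition_blockE pA yA.
  by rewrite (h_inj B B') // (h_onto (h B) y).
apply/eqP; rewrite eqEsubset; apply/andP; split; apply/subsetP => B Bp.
  by rewrite -(h_id B Bp); case: (hP B Bp).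
by have /imsetP[C Cp ->] := subsetP sub_h _ Bp; rewrite h_id.
Qed.

(** A stand-in for the covering relation that is easy to check on products; it implies covering
    because a proper refinement has more blocks ([refine_card]). *)
Definition merge_step pi sigma : bool :=
  refine pi sigma && (#|pi| == #|sigma|.+1).

End Refinement.

(* [lia] preprocesses every hypothesis; keeping only order facts makes it fast *)
Ltac order_lia :=
  repeat match goal with
  | H : ?P |- _ => lazymatch type of P with Prop =>
      lazymatch P with
      | is_true (leq _ _) => fail
      | is_true (andb (leq _ _) (leq _ _)) => fail
      | is_true (negb (andb (leq _ _) (leq _ _))) => fail
      | is_true (negb (eq_op _ _)) => fail
      | is_true (leq _ _) \/ is_true (leq _ _) => fail
      | _ => clear H
      end end
  end; lia.

Section NoncrossingPartitions.
Variables (T : finType) (k : T -> nat) (L : T -> T -> T -> bool).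
Hypothesis k_inj : injective k.
(** If a point of a convex arc lies on the chord from [w] to [z], the arc between them is straight;
    [Ll] and [Lr] are two instances of this. *)
Hypothesis Ll : forall w x y z, k w < k x -> k x < k y -> k y < k z ->
  L w x z -> L w x y.
Hypothesis Lr : forall w x y z, k w < k x -> k x < k y -> k y < k z ->
  L w y z -> L x y z.
Implicit Types (A B C : {set T}) (pi sigma rho : {set {set T}}).

(* Points sit on a convex arc in the order given by [k]; [L a x b] says that the
   triple is collinear, in which case [x] lies on the chord from [a] to [b]. *)
Definition crosses B C : bool :=
  [exists a in B, exists b in B, exists x in C, (k a < k x < k b) &&
    (L a x b || [exists y in C, (k y < k a) || (k b < k y)])].

Lemma crossesP B C :
  reflect (exists a b x, [/\ a \in B, b \in B & x \in C] /\
    [/\ k a < k x, k x < k b &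
        L a x b \/ exists2 y, y \in C & k y < k a \/ k b < k y])
    (crosses B C).
Proof.
apply: (iffP exists_inP) => [[a aB /exists_inP[b bB /exists_inP[x xC]]]|].
  case/andP=> /andP[ax xb] H; exists a, b, x; split=> //; split=> //.
  by case/orP: H => [|/exists_inP[y yC /orP yab]]; [left|right; exists y].
move=> [a [b [x [[aB bB xC] [ax xb H]]]]].
exists a => //; apply/exists_inP; exists b => //; apply/exists_inP; exists x => //.
rewrite ax xb /=; case: H => [->//|[y yC yab]]; apply/orP; right.
by apply/exists_inP; exists y => //; apply/orP.
Qed.

Lemma crossesS B B' C C' : B \subset B' -> C \subset C' ->
  crosses B C -> crosses B' C'.
Proof.
move=> /subsetP BB' /subsetP CC' /crossesP[a [b [x [[aB bB xC] [ax xb H]]]]].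
apply/crossesP; exists a, b, x; split; first by split; auto.
by split=> //; case: H => [|[y yC yab]]; [left|right; exists y; auto].
Qed.

Definition uncrossed pi : bool :=
  [forall B in pi, forall C in pi, (B != C) ==> ~~ crosses B C].

Lemma uncrossedP pi :
  reflect (forall B C, B \in pi -> C \in pi -> B != C -> ~~ crosses B C)
          (uncrossed pi).
Proof.
apply: (iffP forall_inP) => [H B C Bp Cp BC|H B Bp].
  by move/forall_inP: (H B Bp) => /(_ C Cp); rewrite BC.
by apply/forall_inP => C Cp; apply/implyP; apply: H.
Qed.

Definition ncpart A pi : bool := partition pi A && uncrossed pi.

(** * Splitting at the minimum and its successor *)

Section RemoveMinimum.
Variables (A' : {set T}) (lo : T).
Hypothesis lo_min : forall x, x \in A' -> k lo < k x.

Let lo_notin : lo \notin A'.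
Proof. by apply/negP => /lo_min; rewrite ltnn. Qed.

Lemma ncpart_singletonU pi : ncpart A' pi -> ncpart (lo |: A') ([set lo] |: pi).
Proof.
move=> /andP[pA /uncrossedP nc]; have sub := partition_block_sub pA.
have lo_out B : B \in pi -> lo \notin B.
  by move=> Bp; apply: contra lo_notin; apply/subsetP/sub.
apply/andP; split; last first.
  apply/uncrossedP => B C /setU1P[->|Bp] /setU1P[->|Cp] BC; last exact: nc.
  - by rewrite eqxx in BC.
  - apply/negP => /crossesP[a [b [x [[/set1P-> /set1P-> _] [lx xl _]]]]]; order_lia.
  - apply/negP => /crossesP[a [b [x [[aB _ /set1P->] [al _ _]]]]].
    by have := lo_min (subsetP (sub _ Bp) _ aB); order_lia.
apply: partitionI.
- move=> x /setU1P[->|xA]; first by exists [set lo]; rewrite !inE eqxx.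
  have [B Bp xB] := partition_blockE pA xA; exists B => //.
  by rewrite inE Bp orbT.
- move=> B /setU1P[->|Bp]; first by rewrite sub1set setU11.
  by rewrite subsetU // sub // orbT.
- move=> B /setU1P[->|Bp]; first by exists lo; rewrite inE.
  exact: partition_block_neq0 pA Bp.
- move=> B C x /setU1P[->|Bp] /setU1P[->|Cp] //.
  + by move=> /set1P-> loC; have := lo_out C Cp; rewrite loC.
  + by move=> xB /set1P E; have := lo_out B Bp; rewrite -E xB.
  + exact: partition_block_eq pA Bp Cp.
Qed.

Lemma ncpart_singletonD pi : ncpart (lo |: A') pi -> [set lo] \in pi ->
  ncpart A' (pi :\ [set lo]).
Proof.
move=> /andP[pA /uncrossedP nc] lop; apply/andP; split; last first.
  by apply/uncrossedP => B C /setD1P[_ Bp] /setD1P[_ Cp]; apply: nc.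
apply: partitionI.
- move=> x xA; have xA' : x \in lo |: A' by rewrite inE xA orbT.
  have [B Bp xB] := partition_blockE pA xA'.
  exists B => //; rewrite inE Bp andbT inE; apply: contraTneq xA => BE.
  by move: xB; rewrite BE => /set1P->.
- move=> B /setD1P[Blo Bp]; apply/subsetP => x xB.
  have := subsetP (partition_block_sub pA Bp) _ xB; rewrite !inE.
  case/orP=> // /eqP xlo; case/negP: Blo; apply/eqP.
  by apply: (partition_block_eq (x := x) pA) => //; rewrite xlo inE.
- by move=> B /setD1P[_]; apply: partition_block_neq0 pA.
- by move=> B C x /setD1P[_ Bp] /setD1P[_ Cp]; apply: partition_block_eq pA Bp Cp.
Qed.

Section FirstArc.
Variable i : T.
Hypothesis iA : i \in A'.

Let A1 := [set x in A' | k x < k i].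
Let A2 := [set x in A' | k i <= k x].

Definition attach B : {set T} := if i \in B then lo |: B else B.

Definition join_arc pi sigma := pi :|: attach @: sigma.

Lemma attachS B C : B \subset C -> attach B \subset attach C.
Proof.
rewrite /attach => BC; case: ifP => [iB|_]; last first.
  by case: ifP => // _; apply: subset_trans BC (subsetUr _ _).
by rewrite (subsetP BC) // setUS.
Qed.

Lemma attachE B x : (x \in attach B) = (x \in B) || (x == lo) && (i \in B).
Proof. by rewrite /attach; case: ifP; rewrite ?inE ?andbF ?orbF // andbT orbC. Qed.

Lemma attachK B : lo \notin B -> attach B :\ lo = B.
Proof.
move=> loB; apply/setP => x; rewrite !inE attachE.
by have [->|] := eqVneq x lo; rewrite ?(negPf loB) ?orbF.
Qed.

Section Blocks.
Variables (pi sigma : {set {set T}}).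
Hypotheses (pA : partition pi A1) (sA : partition sigma A2).

Lemma join_arcl B x : B \in pi -> x \in B -> x \in A' /\ k lo < k x < k i.
Proof.
move=> Bp xB; have := subsetP (partition_block_sub pA Bp) _ xB.
by rewrite inE => /andP[xA ->]; rewrite lo_min.
Qed.

Lemma join_arcr C x : C \in sigma -> x \in C ->
  [/\ x \in A', k lo < k x & k i <= k x].
Proof.
move=> Cs xC; have := subsetP (partition_block_sub sA Cs) _ xC.
by rewrite inE => /andP[xA ->]; rewrite lo_min.
Qed.

Lemma attach_inj_in : {in sigma &, injective attach}.
Proof.
have lo_out B : B \in sigma -> lo \notin B.
  by move=> Bs; apply/negP => /(join_arcr Bs)[]; rewrite ltnn.
by move=> B C Bs Cs E; rewrite -(attachK (lo_out _ Bs)) E attachK ?lo_out.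
Qed.

Lemma join_arc_disjoint : [disjoint pi & attach @: sigma].
Proof.
apply/pred0P => B /=; apply/negP => /andP[Bp /imsetP[C Cs BE]].
have [x xC] := partition_block_neq0 sA Cs.
have xB : x \in B by rewrite BE attachE xC.
by have [_ ?] := join_arcl Bp xB; have [_ _ ?] := join_arcr Cs xC; order_lia.
Qed.

Lemma card_join_arc : #|join_arc pi sigma| = #|pi| + #|sigma|.
Proof.
rewrite /join_arc cardsU (card_in_imset attach_inj_in).
by rewrite (disjoint_setI0 join_arc_disjoint) cards0 subn0.
Qed.

(** With [join_arcKr] this inverts [join_arc]: the blocks inside the arc are those contained in
    [A1], and the others only have to lose [lo]. *)
Lemma join_arcKl : [set B in join_arc pi sigma | B \subset A1] = pi.
Proof.
apply/setP => B; rewrite !inE; apply/andP/idP => [[]|Bp]; last first.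
  by rewrite Bp (partition_block_sub pA).
case/orP=> // /imsetP[C Cs ->] /subsetP CA; have [x xC] := partition_block_neq0 sA Cs.
have /CA : x \in attach C by rewrite attachE xC.
by have [_ _] := join_arcr Cs xC; rewrite inE; order_lia.
Qed.

Lemma join_arcKr :
  [set B :\ lo | B in join_arc pi sigma :\: pi] = sigma.
Proof.
have -> : join_arc pi sigma :\: pi = attach @: sigma.
  apply/setP => B; rewrite !inE; case Bp: (B \in pi) => //=.
  by have /pred0P/(_ B) /= := join_arc_disjoint; rewrite Bp /= => ->.
rewrite -imset_comp -[RHS]imset_id; apply: eq_in_imset => B Bs /=.
by rewrite attachK //; apply/negP => /(join_arcr Bs)[]; rewrite ltnn.
Qed.

Lemma partition_join_arc : partition (join_arc pi sigma) (lo |: A').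
Proof.
have sat x C : C \in sigma -> x \in attach C ->
    (x = lo /\ i \in C) \/ (x \in C /\ k i <= k x).
  move=> Cs; rewrite attachE => /orP[xC|/andP[/eqP-> iC]]; last by left.
  by right; have [] := join_arcr Cs xC.
apply: partitionI.
- have cov2 x : x \in A2 -> exists2 C, C \in sigma & x \in C.
    exact: partition_blockE sA.
  move=> x /setU1P[->|xA].
    have [C Cs iC] : exists2 C, C \in sigma & i \in C by apply: cov2; rewrite inE iA leqnn.
    exists (attach C); last by rewrite attachE iC eqxx orbT.
    by rewrite inE imset_f ?orbT.
  have [xi|ix] := ltnP (k x) (k i).
    have xA1 : x \in A1 by rewrite inE xA xi.
    by have [B Bp xB] := partition_blockE pA xA1; exists B => //; rewrite inE Bp.
  have [C Cs xC] : exists2 C, C \in sigma & x \in C by apply: cov2; rewrite inE xA.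
  by exists (attach C); rewrite ?attachE ?xC // inE imset_f ?orbT.
- move=> B /setUP[Bp|/imsetP[C Cs ->]]; apply/subsetP => x.
    by move=> /(join_arcl Bp)[xA _]; rewrite inE xA orbT.
  move=> xC; rewrite !inE; case: (sat x C Cs xC) => [[-> _]|[/(join_arcr Cs)[-> _ _] _]].
    by rewrite eqxx.
  by rewrite orbT.
- move=> B /setUP[Bp|/imsetP[C Cs ->]]; first exact: partition_block_neq0 pA Bp.
  by have [x xC] := partition_block_neq0 sA Cs; exists x; rewrite attachE xC.
- have mixed B C x : B \in pi -> C \in sigma -> x \in B -> x \in attach C -> False.
    move=> Bp Cs /(join_arcl Bp)[_ ?] /(sat x C Cs)[[? _]|[_ ?]]; subst; order_lia.
  move=> B D' x /setUP[Bp|/imsetP[C Cs ->]] /setUP[Dp|/imsetP[D Ds ->]].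
  + exact: partition_block_eq pA Bp Dp.
  + by move=> xB /(mixed _ _ _ Bp Ds xB).
  + by move=> xC xD; case: (mixed _ _ _ Dp Cs xD xC).
  + move=> /(sat x C Cs) xC /(sat x D Ds) xD; congr attach.
    have lo_out E : E \in sigma -> lo \notin E.
      by move=> Es; apply/negP => /(join_arcr Es)[]; rewrite ltnn.
    case: xC xD => [[-> iC]|[xC _]] [[E iD]|[xD _]].
    * exact: partition_block_eq sA Cs Ds iC iD.
    * by have := lo_out D Ds; rewrite xD.
    * by have := lo_out C Cs; rewrite -E xC.
    * exact: partition_block_eq sA Cs Ds xC xD.
Qed.

End Blocks.

(** The only new chords run from [lo] to points [b] of the block of [i]. Such a chord meets an inner
    block only in a point of that block, which by [Ll] then lies on the chord from [lo] to [i] too,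
    and this is excluded. In a crossing of two outer blocks [lo] can be replaced by [i], with [Lr]
    for collinear triples. *)
Lemma ncpart_join_arc pi sigma :
  (forall x, x \in A' -> k x < k i -> ~~ L lo x i) ->
  ncpart A1 pi -> ncpart A2 sigma -> ncpart (lo |: A') (join_arc pi sigma).
Proof.
move=> nL /andP[pA /uncrossedP np] /andP[sA /uncrossedP ns].
rewrite /ncpart partition_join_arc //=; apply/uncrossedP.
have sat x C : C \in sigma -> x \in attach C ->
    (x = lo /\ i \in C) \/ [/\ x \in C, k i <= k x & k lo < k x].
  move=> Cs; rewrite attachE => /orP[xC|/andP[/eqP-> iC]]; last by left.
  by right; have [] := join_arcr sA Cs xC.
move=> B D' /setUP[Bp|/imsetP[C Cs ->]] /setUP[Dp|/imsetP[D Ds ->]].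
- exact: np.
- move=> _; apply/negP => /crossesP[a [b [x [[aB bB xD] [ax xb _]]]]].
  have [_ ?] := join_arcl pA Bp aB; have [_ ?] := join_arcl pA Bp bB.
  by case: (sat _ _ Ds xD) => [[? _]|[_ ? ?]]; subst; order_lia.
- move=> _; apply/negP => /crossesP[a [b [x [[aC bC xD] [ax xb H]]]]].
  have [xA ?] := join_arcl pA Dp xD.
  case: (sat _ _ Cs aC) => [[? iC]|[_ ? ?]]; last by order_lia.
  case: (sat _ _ Cs bC) => [[? _]|[bC' ib _]]; first by subst; order_lia.
  subst a; case: H => [Lb|[y yD [?|?]]].
  + have xi : k x < k i by order_lia.
    have [bi|bi] := eqVneq b i; first by move: (nL x xA xi); rewrite -bi Lb.
    have ib' : k i < k b by rewrite ltn_neqAle ib (inj_eq k_inj) eq_sym bi.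
    by move: (nL x xA xi); rewrite (Ll ax xi ib' Lb).
  + by have [_ ?] := join_arcl pA Dp yD; order_lia.
  + by have [_ ?] := join_arcl pA Dp yD; order_lia.
- move=> CD; have {}CD : C != D by apply: contraNneq CD => ->.
  have iCD x : i \in C -> x \in D -> k i < k x.
    move=> iC xD; have [_ _ ix] := join_arcr sA Ds xD.
    rewrite ltn_neqAle ix andbT (inj_eq k_inj); apply: contraNneq CD => E.
    by apply/eqP/(partition_block_eq sA Cs Ds iC); rewrite E.
  have iDC x : i \in D -> x \in C -> k i < k x.
    move=> iD xC; have [_ _ ix] := join_arcr sA Cs xC.
    rewrite ltn_neqAle ix andbT (inj_eq k_inj); apply: contraNneq CD => E.
    by apply/eqP/(partition_block_eq sA Cs Ds _ iD); rewrite E.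
  apply: contra (ns _ _ Cs Ds CD).
  move=> /crossesP[a [b [x [[aC bC xD] [ax xb H]]]]].
  case: (sat _ _ Cs bC) => [[? _]|[{}bC ? ?]].
    by case: (sat _ _ Cs aC) => [[? _]|[_ ? ?]]; subst; order_lia.
  case: (sat _ _ Ds xD) => [[? _]|[{}xD ? ?]].
    by case: (sat _ _ Cs aC) => [[? _]|[_ ? ?]]; subst; order_lia.
  case: (sat _ _ Cs aC) => [[? iC]|[{}aC ? ?]].
    subst a; have ix := iCD x iC xD; have li := lo_min iA.
    apply/crossesP; exists i, b, x; split=> //; split=> //.
    case: H => [Lb|[y yD ?]]; first by left; apply: Lr Lb.
    case: (sat _ _ Ds yD) => [[? _]|[{}yD ? ?]]; first by subst; order_lia.
    by right; exists y => //; order_lia.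
  apply/crossesP; exists a, b, x; split=> //; split=> //.
  case: H => [Lb|[y yD ?]]; first by left.
  right; case: (sat _ _ Ds yD) => [[? iD]|[{}yD ? ?]]; last by exists y.
  by exists i => //; left; apply: iDC.
Qed.

(** [B] contains both ends of the chord from [lo] to [i] and no point between them in the order. A
    point of [A'] on the chord would make its block cross [B], and every other block stays on one
    side of [i]. *)
Lemma ncpart_split_arc pi B : ncpart (lo |: A') pi ->
  B \in pi -> lo \in B -> i \in B ->
  (forall x, x \in B -> x != lo -> k i <= k x) ->
  (forall x, x \in A' -> k x < k i -> ~~ L lo x i) /\
  exists pi1 pi2, [/\ ncpart A1 pi1, ncpart A2 pi2 & pi = join_arc pi1 pi2].
Proof.
move=> /andP[pA /uncrossedP nc] Bp loB iB i_min; have li := lo_min iA.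
have xBF x : x \in A' -> k x < k i -> x \notin B.
  move=> xA xi; apply/negP => xB; have := i_min x xB; have := lo_min xA.
  by move=> ?; case: eqVneq => [?|_ /(_ isT)]; [subst; order_lia|order_lia].
have blk C x : C \in pi -> x \in C -> x = lo \/ x \in A'.
  by move=> Cp xC; apply/setU1P/(subsetP (partition_block_sub pA Cp)).
have lo_out C : C \in pi -> C != B -> lo \notin C.
  by move=> Cp; apply: contraNN => loC; apply/eqP/(partition_block_eq pA Cp Bp loC).
split.
  move=> x xA xi; apply/negP => Lx.
  have xA' : x \in lo |: A' by rewrite inE xA orbT.
  have [C Cp xC] := partition_blockE pA xA'.
  have BC : B != C by apply: contraNneq (xBF x xA xi) => ->.
  case/negP: (nc _ _ Bp Cp BC); apply/crossesP; exists lo, i, x.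
  by split=> //; split=> //; [apply: lo_min|left].
(* a block with points on both sides of [i] would cross the block of [lo] *)
have dich C : C \in pi -> ~~ (C \subset A1) ->
    forall x, x \in C -> x = lo \/ x \in A2.
  move=> Cp CA x xC; case: (blk C x Cp xC) => [->|xA]; [by left|right].
  rewrite inE xA leqNgt; apply/negP => xi.
  have BC : B != C by apply: contraNneq (xBF x xA xi) => ->.
  case/subsetPn: CA => y yC; rewrite inE negb_and.
  case: (blk C y Cp yC) => [ylo|yA].
    by move=> _; have := lo_out C Cp; rewrite eq_sym BC -ylo yC => /(_ isT).
  rewrite yA -leqNgt /= => iy.
  have {}iy : k i < k y.
    rewrite ltn_neqAle iy andbT (inj_eq k_inj); apply: contraNneq BC => E.
    by apply/eqP/(partition_block_eq pA Bp Cp iB); rewrite E.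
  case/negP: (nc _ _ Bp Cp BC); apply/crossesP; exists lo, i, x.
  split=> //; split=> //; first exact: lo_min.
  by right; exists y => //; right.
have BnA1 : ~~ (B \subset A1).
  by apply/subsetPn; exists i => //; rewrite inE ltnn andbF.
have remE C x : (x \in C :\ lo) = (x != lo) && (x \in C) by rewrite !inE.
(* The formulas of [join_arcKl] and [join_arcKr] dictate the two factors. *)
pose pi1 := [set C in pi | C \subset A1].
pose pi2 := [set C :\ lo | C in pi :\: pi1].
have pi2P C : C \in pi :\: pi1 -> C \in pi /\ ~~ (C \subset A1).
  by rewrite !inE; case: (C \in pi); rewrite ?andbF //= andbT.
exists pi1, pi2; split.
- apply/andP; split; last first.
    by apply/uncrossedP => C D; rewrite !inE => /andP[Cp _] /andP[Dp _]; apply: nc.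
  apply: partitionI.
  + move=> x xA1; have := xA1; rewrite inE => /andP[xA xi].
    have xA' : x \in lo |: A' by rewrite inE xA orbT.
    have [C Cp xC] := partition_blockE pA xA'; exists C => //.
    rewrite inE Cp /=; apply: contraT => CA.
    have lx := lo_min xA.
    by case: (dich C Cp CA x xC) => [?|]; [subst; order_lia|rewrite inE; order_lia].
  + by move=> C; rewrite inE => /andP[].
  + by move=> C; rewrite inE => /andP[Cp _]; apply: partition_block_neq0 pA Cp.
  + move=> C D x; rewrite !inE => /andP[Cp _] /andP[Dp _].
    exact: partition_block_eq pA Cp Dp.
- apply/andP; split; last first.
    apply/uncrossedP => _ _ /imsetP[C /pi2P[Cp _] ->] /imsetP[D /pi2P[Dp _] ->] CD.
    have {}CD : C != D by apply: contraNneq CD => ->.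
    by apply: contra (nc _ _ Cp Dp CD); apply: crossesS; apply: subsetDl.
  apply: partitionI.
  + move=> x; rewrite inE => /andP[xA xi].
    have xA' : x \in lo |: A' by rewrite inE xA orbT.
    have [C Cp xC] := partition_blockE pA xA'; exists (C :\ lo).
      apply: imset_f; rewrite !inE Cp andbT /=; apply/negP => /subsetP/(_ x xC).
      by rewrite inE; order_lia.
    by rewrite remE xC andbT; apply: contraTneq xA => ->.
  + move=> _ /imsetP[C /pi2P[Cp CA] ->]; apply/subsetP => x.
    rewrite remE => /andP[xlo xC].
    by case: (dich C Cp CA x xC) => // xlo'; rewrite xlo' eqxx in xlo.
  + move=> _ /imsetP[C /pi2P[Cp CA] ->].
    have [->|CB] := eqVneq C B.
      by exists i; rewrite remE iB andbT; apply: contraTneq iA => ->.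
    have [x xC] := partition_block_neq0 pA Cp; exists x; rewrite remE xC andbT.
    by apply: contraTneq xC => ->; apply: lo_out.
  + move=> _ _ x /imsetP[C /pi2P[Cp _] ->] /imsetP[D /pi2P[Dp _] ->].
    rewrite !remE => /andP[_ xC] /andP[_ xD].
    by rewrite (partition_block_eq pA Cp Dp xC xD).
- have attK C : C \in pi -> attach (C :\ lo) = C.
    move=> Cp; apply/setP => x; rewrite attachE !remE.
    have [->/=|//] := eqVneq x lo; last by rewrite orbF.
    have -> : i != lo by apply: contraTneq iA => ->.
    apply/idP/idP => [iC|loC]; first by rewrite (partition_block_eq pA Cp Bp iC iB).
    by rewrite (partition_block_eq pA Cp Bp loC loB).
  apply/setP => C; rewrite inE -imset_comp; apply/idP/orP => [Cp|].
    case C1: (C \in pi1); [by left|right].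
    by apply/imsetP; exists C => /=; rewrite ?attK // inE C1.
  case=> [|/imsetP[D /pi2P[Dp _] -> /=]]; last by rewrite attK.
  by rewrite inE => /andP[].
Qed.

End FirstArc.
End RemoveMinimum.
(* The successor of [lo] in its block, or [j] when [lo] is a singleton block. *)
Definition arc_end (lo j : T) pi : T :=
  odflt j [pick i in pblock pi lo :\ lo |
            [forall x in pblock pi lo :\ lo, k i <= k x]].

Lemma arc_end_eq A lo j i pi B : partition pi A -> B \in pi -> lo \in B ->
  i \in B -> i != lo -> (forall x, x \in B -> x != lo -> k i <= k x) ->
  arc_end lo j pi = i.
Proof.
move=> pA Bp loB iB ilo i_min; rewrite /arc_end.
have -> : pblock pi lo = B by case/and3P: pA => _ tI _; apply: def_pblock.
case: pickP => [x|/(_ i)] /=; rewrite !inE.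
  case/andP=> /andP[xlo xB] /forall_inP x_min; apply: k_inj; apply: anti_leq.
  by rewrite i_min // x_min // !inE ilo.
rewrite ilo iB /= => /forall_inP[] x; rewrite !inE => /andP[xlo xB].
exact: i_min.
Qed.

Lemma arc_end_singleton A lo j pi : partition pi A -> [set lo] \in pi ->
  arc_end lo j pi = j.
Proof.
move=> pA lop; rewrite /arc_end.
have -> : pblock pi lo = [set lo].
  by case/and3P: pA => _ tI _; apply: def_pblock => //; rewrite inE.
by case: pickP => // x; rewrite !inE; case: (x == lo).
Qed.

Lemma arc_endP A lo j pi : partition pi A -> lo \in A ->
  [set lo] \in pi \/
  exists B, [/\ B \in pi, lo \in B, arc_end lo j pi \in B,
    arc_end lo j pi != lo &
    forall x, x \in B -> x != lo -> k (arc_end lo j pi) <= k x].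
Proof.
move=> pA loA; have [B Bp loB] := partition_blockE pA loA.
have [B0|[i0 i0B]] := set_0Vmem (B :\ lo).
  by left; rewrite (_ : [set lo] = B) // -(setD1K loB) B0 setU0.
right; exists B; have [i] := @arg_minnP _ i0 [in B :\ lo] k i0B.
rewrite !inE => /andP[ilo iB] i_min.
have {}i_min x : x \in B -> x != lo -> k i <= k x.
  by move=> xB xlo; apply: i_min; rewrite !inE xlo.
by rewrite (arc_end_eq j pA Bp loB iB ilo i_min).
Qed.

Lemma arc_end_join A' lo j i pi sigma :
  (forall x, x \in A' -> k lo < k x) -> i \in A' ->
  partition pi [set x in A' | k x < k i] ->
  partition sigma [set x in A' | k i <= k x] ->
  arc_end lo j (join_arc lo i pi sigma) = i.
Proof.
move=> lo_min iA pA sA; have pJ := partition_join_arc lo_min iA pA sA.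
have iA2 : i \in [set x in A' | k i <= k x] by rewrite inE iA leqnn.
have [C Cs iC] := partition_blockE sA iA2.
apply: (arc_end_eq j pJ (B := attach lo i C)).
- by rewrite inE imset_f ?orbT.
- by rewrite attachE iC eqxx orbT.
- by rewrite attachE iC.
- by apply: contraTneq (lo_min i iA) => ->; rewrite ltnn.
- move=> x; rewrite attachE => /orP[xC _|/andP[->]] //.
  by have [] := join_arcr lo_min sA Cs xC.
Qed.

(** [false] stands for [lo] alone and [true] for [lo] attached; the former has one block more,
    whence the rank [~~ b]. *)
Lemma scd_bool :
  scd (fun b b' => ~~ b && b') (fun b => ~~ b : nat) xpredT 1.
Proof. by exists [:: [:: false; true]]; split=> // -[]. Qed.

Lemma merge_step_card pi sigma : merge_step pi sigma -> #|pi| = #|sigma|.+1.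
Proof. by case/andP=> _ /eqP. Qed.

Lemma merge_step_join_arcl lo i pi pi' sigma :
  #|join_arc lo i pi sigma| = #|pi| + #|sigma| ->
  #|join_arc lo i pi' sigma| = #|pi'| + #|sigma| ->
  merge_step pi pi' -> merge_step (join_arc lo i pi sigma) (join_arc lo i pi' sigma).
Proof.
rewrite /merge_step => -> -> /andP[r /eqP->]; rewrite addSn eqxx andbT.
by apply: refineU => //; apply: refinexx.
Qed.

Lemma merge_step_join_arcr lo i pi sigma sigma' :
  #|join_arc lo i pi sigma| = #|pi| + #|sigma| ->
  #|join_arc lo i pi sigma'| = #|pi| + #|sigma'| ->
  merge_step sigma sigma' ->
  merge_step (join_arc lo i pi sigma) (join_arc lo i pi sigma').
Proof.
rewrite /merge_step => -> -> /andP[r /eqP->]; rewrite addnS eqxx andbT.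
apply: refineU; first exact: refinexx.
by apply: refine_imset => // B C; apply: attachS.
Qed.

(** * Symmetric chains in the fibres of the successor map *)

Section Fibers.
Variables (A' : {set T}) (lo j : T).
Hypothesis lo_min : forall x, x \in A' -> k lo < k x.
Hypothesis jA : j \in A'.
Hypothesis j_min : forall x, x \in A' -> k j <= k x.
Let A := lo |: A'.

Let loA : lo \in A. Proof. exact: setU11. Qed.

Let lo_notin pi : partition pi A' -> [set lo] \notin pi.
Proof.
move=> pA; apply/negP => /(partition_block_sub pA); rewrite sub1set => /lo_min.
by rewrite ltnn.
Qed.

Let ncP X pi : ncpart X pi -> partition pi X.
Proof. by case/andP. Qed.

(** A point of [A'] before [i] means that [i] is not [j], so the partitions with [lo] as a
    singleton, sent to [j] by default, stay out of this fibre. *)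
Lemma scd_fiber i : i \in A' ->
  (exists2 x, x \in A' & k x < k i) ->
  scd (@merge_step T) (fun pi => #|pi|)
      (ncpart [set x in A' | k x < k i]) #|[set x in A' | k x < k i]|.+1 ->
  scd (@merge_step T) (fun pi => #|pi|)
      (ncpart [set x in A' | k i <= k x]) #|[set x in A' | k i <= k x]|.+1 ->
  scd (@merge_step T) (fun pi => #|pi|)
      [pred pi | ncpart A pi && (arc_end lo j pi == i)] #|A|.+1.
Proof.
move=> iA [x0 x0A x0i]; set A1 := [set x in A' | _]; set A2 := [set x in A' | _].
move=> scd1 scd2.
have [nL|] := boolP [forall x in A', (k x < k i) ==> ~~ L lo x i]; last first.
  move=> /forall_inP nL; apply: eq_scd (scd0 _ _ _) => pi; apply/esym/negP.
  case/andP=> ncA /eqP E; have pA := ncP ncA; apply: nL => x xA.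
  apply/implyP; move: x xA; case: (arc_endP j pA loA) => [/(arc_end_singleton j pA)|].
    by rewrite E => ij; have := j_min x0A; rewrite -ij => ?; exfalso; order_lia.
  rewrite E => -[B [Bp loB iB ilo i_min]].
  by have [] := ncpart_split_arc lo_min iA ncA Bp loB iB i_min.
have {}nL x : x \in A' -> k x < k i -> ~~ L lo x i.
  by move=> xA; move/forall_inP: nL => /(_ x xA)/implyP.
have cardA : #|A|.+1 = #|A1|.+1 + #|A2|.+1.
  rewrite /A cardsU1 (_ : lo \notin A') //=; last first.
    by apply/negP => /lo_min; rewrite ltnn.
  rewrite (_ : A' = A1 :|: A2); last first.
    by apply/setP => x; rewrite !inE -andb_orr ltnNge orNb andbT.
  have A12 : A1 :&: A2 = set0.
    by apply/setP => x; rewrite !inE ltnNge; case: leqP; rewrite ?andbF.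
  by rewrite cardsU A12 cards0 subn0 add1n addSn addnS.
rewrite cardA.
have cJ pi sigma : ncpart A1 pi -> ncpart A2 sigma ->
    #|join_arc lo i pi sigma| = #|pi| + #|sigma|.
  by move=> /ncP pA /ncP sA; rewrite (card_join_arc lo_min pA sA).
apply: (scd_product (f := join_arc lo i)) scd1 scd2 _ => //.
- exact: merge_step_card.
- exact: merge_step_card.
- by move=> pi pi' sigma p1 p2 s1; apply: merge_step_join_arcl; apply: cJ.
- by move=> pi sigma sigma' p1 s1 s2; apply: merge_step_join_arcr; apply: cJ.
- move=> pi pi' sigma sigma' /ncP p1 /ncP p2 /ncP s1 /ncP s2 E.
  have E1 : pi = pi' by rewrite -(join_arcKl lo_min p1 s1) E join_arcKl.
  split=> //; subst pi'.
  by rewrite -(join_arcKr lo_min p1 s1) E (join_arcKr lo_min p1 s2).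
- move=> z; apply: (iffP andP) => [[ncz /eqP E]|].
    have pA := ncP ncz.
    case: (arc_endP j pA loA) => [/(arc_end_singleton j pA)|].
      by rewrite E => ij; have := j_min x0A; rewrite -ij => ?; exfalso; order_lia.
    rewrite E => -[B [Bp loB iB ilo i_min]].
    have [_ [pi1 [pi2 [? ? ?]]]] := ncpart_split_arc lo_min iA ncz Bp loB iB i_min.
    by exists pi1, pi2.
  move=> [pi [sigma [p1 s1 ->]]]; split; first exact: ncpart_join_arc.
  by rewrite (arc_end_join j lo_min iA (ncP p1) (ncP s1)).
Qed.

(** The partitions with [lo] alone and those with [lo] in the block of [j] are two copies of the
    partitions of [A'], with centres one too high and one too low. Attaching [lo] to the block of
    [j] is a merge step, so together they form a centred product; this is the reason for the default
    [j] in [arc_end]. *)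
Lemma scd_first_fiber :
  scd (@merge_step T) (fun pi => #|pi|) (ncpart A') #|A'|.+1 ->
  scd (@merge_step T) (fun pi => #|pi|)
      [pred pi | ncpart A pi && (arc_end lo j pi == j)] #|A|.+1.
Proof.
move=> scdA'.
have A1E : [set x in A' | k x < k j] = set0.
  apply/setP => x; rewrite !inE; apply/negP => /andP[/j_min]; order_lia.
have A2E : [set x in A' | k j <= k x] = A'.
  by apply/setP => x; rewrite inE; apply/andb_idr/j_min.
(* No point of [A'] precedes [j], so the inner factor of [join_arc] is the empty partition. *)
have p0 : partition set0 [set x in A' | k x < k j].
  by rewrite A1E partition_set0.
pose f pi (b : bool) := if b then join_arc lo j set0 pi else [set lo] |: pi.
have f_card pi b : partition pi A' -> #|f pi b| = #|pi| + ~~ b.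
  move=> pA; case: b => /=; last by rewrite cardsU1 lo_notin // addnC.
  by rewrite (card_join_arc lo_min p0) ?cards0 ?addn0 // A2E.
rewrite /A cardsU1 (_ : lo \notin A') /=; last first.
  by apply/negP => /lo_min; rewrite ltnn.
rewrite add1n -addn1.
apply: (scd_product (f := f)) scdA' scd_bool _ => //.
- exact: merge_step_card.
- by case=> -[].
- move=> pi pi' b /ncP p1 /ncP p2 _ /andP[r /eqP E].
  rewrite /merge_step !f_card // E eqxx andbT; case: b => /=.
    apply: refineU; first exact: refinexx.
    by apply: refine_imset => // B C; apply: attachS.
  by apply: refineU => //; apply: refinexx.
- move=> pi [] [] // /ncP pA _ _ _.
  rewrite /merge_step !f_card // addn0 addn1 eqxx andbT.
  apply/refineP => B /setU1P[->|Bp]; last first.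
    exists (attach lo j B); first by rewrite inE imset_f ?orbT.
    by rewrite /attach; case: ifP => // _; apply: subsetUr.
  have [C Cp jC] := partition_blockE pA jA.
  exists (attach lo j C); first by rewrite inE imset_f ?orbT.
  by rewrite sub1set attachE jC eqxx orbT.
- by move=> pi b /ncP pA _; apply: f_card.
- have singleton_join pi pi' : partition pi A' -> partition pi' A' ->
      [set lo] |: pi != join_arc lo j set0 pi'.
    move=> p1 p2; apply/eqP => /setP/(_ [set lo]); rewrite setU11 inE in_set0 /=.
    move/esym/imsetP => [C Cp E].
    have [x xC] := partition_block_neq0 p2 Cp.
    have : x \in [set lo] by rewrite E attachE xC.
    move/set1P => xlo; have := lo_min (subsetP (partition_block_sub p2 Cp) _ xC).
    by rewrite xlo ltnn.
  move=> pi pi' b b' /ncP p1 /ncP p2 _ _; case: b b' => [] [] /= E.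
  + split=> //; rewrite -A2E in p1 p2.
    by rewrite -(join_arcKr lo_min p0 p1) E (join_arcKr lo_min p0 p2).
  + by have := singleton_join _ _ p2 p1; rewrite E eqxx.
  + by have := singleton_join _ _ p1 p2; rewrite E eqxx.
  + by split=> //; rewrite -(setU1K (lo_notin p1)) E setU1K ?lo_notin.
- move=> z; apply: (iffP andP) => [[ncz /eqP E]|].
    have pA := ncP ncz.
    case: (arc_endP j pA loA) => [loz|].
      exists (z :\ [set lo]), false; split=> //; last by rewrite /= setD1K.
      exact: ncpart_singletonD.
    rewrite E => -[B [Bp loB jB jlo jB_min]].
    have [_ [pi1 [pi2 []]]] := ncpart_split_arc lo_min jA ncz Bp loB jB jB_min.
    rewrite A1E A2E => /ncP; rewrite partition_set0 => /eqP-> ? ->.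
    by exists pi2, true.
  move=> [pi [b [p1 _ ->]]]; case: b => /=.
    split; last first.
      by apply/eqP/(arc_end_join _ lo_min jA p0); rewrite A2E (ncP p1).
    apply: ncpart_join_arc => //; rewrite ?A2E //.
    + by move=> x /j_min ?; order_lia.
    + rewrite A1E /ncpart partition_set0 eqxx /=.
      by apply/uncrossedP => B C; rewrite inE.
  have ncz := ncpart_singletonU lo_min p1; split=> //.
  by apply/eqP/(arc_end_singleton _ (ncP ncz)); rewrite setU11.
Qed.

End Fibers.

Lemma ncpart0 pi : ncpart set0 pi = (pi == set0).
Proof.
rewrite /ncpart partition_set0; case: eqP => //= ->.
by apply/uncrossedP => B C; rewrite inE.
Qed.

Lemma ncpart1 x pi : ncpart [set x] pi = (pi == [set [set x]]).
Proof.
have x_min y : y \in set0 -> k x < k y by rewrite inE.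
apply/idP/eqP => [nc|->]; last first.
  have /(ncpart_singletonU x_min) : ncpart set0 set0 by rewrite ncpart0.
  by rewrite !setU0.
have pA : partition pi [set x] by case/andP: nc.
have [B Bp xB] := partition_blockE pA (set11 x).
have BE : B = [set x].
  by apply/eqP; rewrite eqEsubset sub1set xB (partition_block_sub pA Bp).
rewrite -(setU0 [set x]) in nc; rewrite BE in Bp.
have := ncpart_singletonD x_min nc Bp; rewrite ncpart0 => /eqP E.
by rewrite -(setD1K Bp) E setU0.
Qed.

Theorem scd_ncpart A : A != set0 ->
  scd (@merge_step T) (fun pi => #|pi|) (ncpart A) #|A|.+1.
Proof.
have [n] := ubnP #|A|; elim: n A => // n IHn A leAn /set0Pn[x0 x0A].
have [lo loA lo_min {x0 x0A}] := @arg_minnP _ x0 [in A] k x0A.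
pose A' := A :\ lo; have AE : A = lo |: A' by rewrite setD1K.
have {}lo_min x : x \in A' -> k lo < k x.
  rewrite !inE => /andP[xlo /lo_min]; rewrite leq_eqVlt (inj_eq k_inj).
  by rewrite eq_sym (negPf xlo).
have [A'0|[x0 x0A]] := set_0Vmem A'.
  have E : A = [set lo] by rewrite AE A'0 setU0.
  rewrite E cards1 -[2]/(1 + 1) -(cards1 [set lo]).
  by apply: eq_scd (scd1 _ _ _) => pi; rewrite ncpart1.
have [j jA j_min {x0 x0A}] := @arg_minnP _ x0 [in A'] k x0A.
have leA'n : #|A'| < n by move: leAn; rewrite AE cardsU1 !inE eqxx.
have IHS B : B \subset A' -> B != set0 ->
    scd (@merge_step T) (fun pi => #|pi|) (ncpart B) #|B|.+1.
  by move=> /subset_leq_card BA; apply: IHn; apply: leq_ltn_trans leA'n.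
apply: (scd_fibers (h := arc_end lo j)) => i.
have [iA|iA] := boolP (i \in A'); last first.
  apply: eq_scd (scd0 _ _ _) => pi; apply/esym/negP => /andP[nc /eqP E].
  have pA : partition pi A by case/andP: nc.
  case: (arc_endP j pA loA) => [/(arc_end_singleton j pA)|].
    by rewrite E => ij; rewrite ij jA in iA.
  move=> [B [Bp _ iB ilo _]]; case/negP: iA; rewrite -E !inE ilo.
  exact: subsetP (partition_block_sub pA Bp) _ iB.
rewrite AE; have [->|ij] := eqVneq i j.
  by apply: scd_first_fiber => //; apply: IHS => //; apply/set0Pn; exists j.
(* With [j] before [i], the piece between [lo] and [i] is nonempty, as the induction hypothesis
   requires. *)
have ji : k j < k i.
  by rewrite ltn_neqAle j_min // (inj_eq k_inj) eq_sym ij.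
apply: scd_fiber => //; first by exists j.
- apply: IHS; first by apply/subsetP => x; rewrite inE => /andP[].
  by apply/set0Pn; exists j; rewrite inE jA.
- apply: IHS; first by apply/subsetP => x; rewrite inE => /andP[].
  by apply/set0Pn; exists i; rewrite inE iA leqnn.
Qed.

End NoncrossingPartitions.

(** * Convex hulls in the plane *)

From mathcomp Require Import all_boot all_order all_algebra finmap ring lra.
From mathcomp Require Import boolp classical_sets reals topology normedtype.
From mathcomp Require Import interval_inference convex.

Import Order.TTheory GRing.Theory Num.Theory.
Import numFieldNormedType.Exports.

Local Open Scope classical_set_scope.
Local Open Scope ring_scope.

Section ConvexHulls.
Variable R : realType.
Local Notation plane := 'rV[R]_2.
Implicit Types (A K : set plane) (x y : plane) (t : R).

Definition affine (phi : plane -> R) : Prop :=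
  forall x y t, phi (t *: x + (1 - t) *: y) = t * phi x + (1 - t) * phi y.

Lemma convex_setP K : @convex_set R plane K <->
  forall x y t, 0 <= t <= 1 -> K x -> K y -> K (t *: x + (1 - t) *: y).
Proof.
split=> [cK x y t t01 Kx Ky|cK x y t].
  have := cK x y (Itv01 (andP t01).1 (andP t01).2).
  by rewrite !inE; apply.
rewrite !inE => Kx Ky; apply: cK => //.
by rewrite ge0 le1.
Qed.

Lemma sub_Conv A : A `<=` Conv A.
Proof. exact: sub_gen_smallest. Qed.

Lemma Conv_min A K : @convex_set R plane K -> A `<=` K -> Conv A `<=` K.
Proof. by move=> cK AK; apply: smallest_sub. Qed.

Lemma Conv_convex A x y t : 0 <= t <= 1 ->
  Conv A x -> Conv A y -> Conv A (t *: x + (1 - t) *: y).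
Proof.
move=> t01 Ax Ay K cAK; have /convex_setP cK := cAK.1.
by apply: cK => //; [apply: Ax|apply: Ay].
Qed.

Lemma affine_le0_convex phi : affine phi ->
  @convex_set R plane [set x | phi x <= 0].
Proof. by move=> aff; apply/convex_setP => x y t t01 /= ? ?; rewrite aff; nra. Qed.

Lemma affine_gt0_convex phi : affine phi ->
  @convex_set R plane [set x | 0 < phi x].
Proof. by move=> aff; apply/convex_setP => x y t t01 /= ? ?; rewrite aff; nra. Qed.

(** One inequality may be weak, so the separating line may run through points of [A], for instance
    along a chord of a block. *)
Lemma Conv_separated A B phi : affine phi ->
  A `<=` [set x | phi x <= 0] -> B `<=` [set x | 0 < phi x] ->
  Conv A `&` Conv B = set0.
Proof.
move=> aff Aphi Bphi; rewrite -subset0 => x [Ax Bx] /=.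
have /= := Conv_min (affine_le0_convex aff) Aphi Ax.
by have /= := Conv_min (affine_gt0_convex aff) Bphi Bx; lra.
Qed.

End ConvexHulls.

(** * Signed areas, barycentric coordinates and interior points *)

Section AffineCoordinates.
Variables (R : realType) (a f : 'rV[R]_2 -> R).
Local Notation plane := 'rV[R]_2.
Hypotheses (a_aff : affine a) (f_aff : affine f).
Hypotheses (a_cont : continuous a) (f_cont : continuous f).
Hypothesis coord_inj : forall x y, a x = a y -> f x = f y -> x = y.
Implicit Types x y z w : plane.

(** The cross product about the origin of the coordinates [(a, f)], signed to be positive when [y]
    follows [x] clockwise by less than a half turn. *)
Definition wedge x y : R := a y * f x - a x * f y.

(* Twice the signed area, positive for clockwise triangles in the coordinates
   [(a, f)]. *)
Definition tri_area x y z : R := wedge y z + wedge x y - wedge x z.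

Lemma area_affine x z : affine (tri_area x ^~ z).
Proof. by move=> v w t; rewrite /tri_area /wedge a_aff f_aff; ring. Qed.

Lemma near_area_gt0 (phi : plane -> R) (c1 c2 c3 : R) w :
  (forall z, phi z = c1 * a z + c2 * f z + c3) -> 0 < phi w ->
  \forall z \near w, 0 < phi z.
Proof.
move=> phiE phi_gt0.
suff phi_cvg : phi @ w --> phi w.
  exact: (@cvgr_gt _ _ (nbhs w) _ phi (phi w) phi_cvg 0).
rewrite (_ : phi = fun z => c1 * a z + c2 * f z + c3); last exact/funext.
have nbhsF : Filter (nbhs w) by exact: (@nbhs_filter plane w).
have cst (c : R) : (fun=> c) @ w --> c by apply: cvg_cst.
exact: (cvgD (cvgD (cvgM (cst c1) (@a_cont w)) (cvgM (cst c2) (@f_cont w)))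
  (cst c3)).
Qed.

Lemma convex_barycenter (K : set plane) x y z w (s t u : R) :
  @convex_set R plane K -> K x -> K y -> K z ->
  0 < s -> 0 < t -> 0 < u -> s + t + u = 1 ->
  a w = s * a x + t * a y + u * a z -> f w = s * f x + t * f y + u * f z -> K w.
Proof.
move=> /convex_setP cK Kx Ky Kz s0 t0 u0 stu aw fw.
have st0 : s + t != 0 by rewrite gt_eqF // addr_gt0.
(* Convexity concerns two points at a time, so [w] is reached through a point [v] between [x] and
   [y]. *)
pose v := (s / (s + t)) *: x + (1 - s / (s + t)) *: y.
have Kv : K v.
  apply: cK => //; apply/andP; split; first by rewrite divr_ge0 // ltW // addr_gt0.
  by rewrite ler_pdivrMr ?addr_gt0 // mul1r lerDl ltW.
have -> : w = (s + t) *: v + (1 - (s + t)) *: z.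
  have E r r' : (s + t) * (s / (s + t) * r + (1 - s / (s + t)) * r') = s * r + t * r'.
    by field.
  have uE : 1 - (s + t) = u by lra.
  by rewrite /v; apply: coord_inj; rewrite !(a_aff, f_aff) E uE.
by apply: cK => //; rewrite ltW ?addr_gt0 //=; lra.
Qed.

(** Divided by the total, the three areas are barycentric coordinates; their positivity is an open
    condition, so it persists near [w]. *)
Lemma triangle_interior (K : set plane) x y z w :
  @convex_set R plane K -> K x -> K y -> K z ->
  0 < tri_area w y z -> 0 < tri_area x w z -> 0 < tri_area x y w -> interior K w.
Proof.
move=> cK Kx Ky Kz wx wy wz; rewrite /interior.
have nx : \forall v \near w, 0 < tri_area v y z.
  apply: (@near_area_gt0 (fun v => tri_area v y z)
    (f z - f y) (a y - a z) (wedge y z)) => // v.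
  by rewrite /tri_area /wedge; ring.
have ny : \forall v \near w, 0 < tri_area x v z.
  apply: (@near_area_gt0 (fun v => tri_area x v z)
    (f x - f z) (a z - a x) (- wedge x z)) => // v.
  by rewrite /tri_area /wedge; ring.
have nz : \forall v \near w, 0 < tri_area x y v.
  apply: (@near_area_gt0 (fun v => tri_area x y v)
    (f y - f x) (a x - a y) (wedge x y)) => // v.
  by rewrite /tri_area /wedge; ring.
near=> v.
have vx : 0 < tri_area v y z by near: v.
have vy : 0 < tri_area x v z by near: v.
have vz : 0 < tri_area x y v by near: v.
have S0 : 0 < tri_area x y z.
  have -> : tri_area x y z = tri_area v y z + tri_area x v z + tri_area x y v.
    by rewrite /tri_area /wedge; ring.
  by apply: addr_gt0; first apply: addr_gt0.
have S1 : tri_area x y z != 0 by rewrite gt_eqF.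
have E1 : 1 = (tri_area v y z + tri_area x v z + tri_area x y v) / tri_area x y z.
  by apply: (mulIf S1); rewrite divfK // /tri_area /wedge; ring.
have Ea : a v =
    (tri_area v y z * a x + tri_area x v z * a y + tri_area x y v * a z) / tri_area x y z.
  by apply: (mulIf S1); rewrite divfK // /tri_area /wedge; ring.
have Ef : f v =
    (tri_area v y z * f x + tri_area x v z * f y + tri_area x y v * f z) / tri_area x y z.
  by apply: (mulIf S1); rewrite divfK // /tri_area /wedge; ring.
apply: (convex_barycenter (x := x) (y := y) (z := z)
  (s := tri_area v y z / tri_area x y z) (t := tri_area x v z / tri_area x y z)
  (u := tri_area x y v / tri_area x y z)) => //; try exact: divr_gt0.
- by rewrite [RHS]E1 !mulrDl.
- by rewrite {1}Ea !mulrDl ![_ / tri_area x y z * _]mulrAC.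
- by rewrite {1}Ef !mulrDl ![_ / tri_area x y z * _]mulrAC.
Unshelve. all: by end_near.
Qed.

End AffineCoordinates.

(** * Configurations with a blank side *)

Section ConvexArc.
Variables (R : realType) (P : {fset 'rV[R]_2}) (a f : 'rV[R]_2 -> R).
Local Notation plane := 'rV[R]_2.
Hypotheses (a_aff : affine a) (f_aff : affine f).
Hypotheses (a_cont : continuous a) (f_cont : continuous f).
Hypothesis coord_inj : forall x y, a x = a y -> f x = f y -> x = y.
Variables p q : P.
(** Coordinates adapted to the side: [f] is the height above its line, [a] the position along it,
    with origin at a point [m] between [p] and [q]. Blankness enters as [f_gt0]. *)
Hypotheses (fp : f (val p) = 0) (fq : f (val q) = 0).
Hypotheses (ap : a (val p) < 0) (aq : 0 < a (val q)).
Hypothesis f_gt0 : forall x : P, x != p -> x != q -> 0 < f (val x).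
Variable m : plane.
Hypotheses (am : a m = 0) (fm : f m = 0) (mP : Conv [set` P] m).
Hypothesis no_interior : forall x : P, ~ interior (Conv [set` P]) (val x).
Implicit Types (x y z w : P) (B C : {set P}).

Local Notation cr x y := (wedge a f (val x) (val y)).
Local Notation area x y z := (tri_area a f (val x) (val y) (val z)).

Let hull_mem x : Conv [set` P] (val x).
Proof. by apply: sub_Conv; rewrite /= (valP x). Qed.

Let hull_convex : @convex_set R plane (Conv [set` P]).
Proof. by apply/convex_setP => x y t; apply: Conv_convex. Qed.

Let not_in_triangle (u v w : plane) x :
  Conv [set` P] u -> Conv [set` P] v -> Conv [set` P] w ->
  0 < tri_area a f (val x) v w -> 0 < tri_area a f u (val x) w ->
  0 < tri_area a f u v (val x) -> False.
Proof.
move=> uK vK wK xvw uxw uvx; apply: (no_interior (x := x)).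
exact: (triangle_interior a_aff f_aff a_cont f_cont coord_inj) xvw uxw uvx.
Qed.

Definition slope_bound : R := 1 + \sum_(x : P) `|a (val x) / f (val x)|.

(* The slope of the ray from [m] through [x], completed by values beyond all
   others at the two endpoints, where the division by [f = 0] is meaningless. *)
Definition slope x : R :=
  if x == p then - slope_bound else
  if x == q then slope_bound else a (val x) / f (val x).

Lemma slope_bounded x : `|a (val x) / f (val x)| < slope_bound.
Proof.
rewrite /slope_bound (bigD1 x) //= addrCA ltrDl ltr_wpDr //.
by apply: sumr_ge0 => i _; apply: normr_ge0.
Qed.

Let pq : p != q.
Proof. by apply: contraTneq ap => ->; rewrite -leNgt ltW. Qed.

Lemma slope_p x : x != p -> slope p < slope x.
Proof.
move=> xp; have := slope_bounded x; have := slope_bounded p.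
rewrite /slope eqxx (negPf xp) !ltr_norml => /andP[pa pb] /andP[xa xb].
by case: ifP => _ //; lra.
Qed.

Lemma slope_q x : x != q -> slope x < slope q.
Proof.
move=> xq; have := slope_bounded x; have := slope_bounded p.
rewrite /slope eqxx (negPf xq) [q == p]eq_sym (negPf pq) !ltr_norml.
by move=> /andP[pa pb] /andP[xa xb]; case: ifP => _ //; lra.
Qed.

Lemma slopeE x : x != p -> x != q -> slope x = a (val x) / f (val x).
Proof. by rewrite /slope => /negPf-> /negPf->. Qed.

(** Of two distinct points on one ray from [m], the lower one would be interior to the triangle
    formed by [p], [q] and the higher one. *)
Lemma slope_inj : injective slope.
Proof.
suff slope_le x y : x != p -> x != q -> y != p -> y != q ->
    slope x = slope y -> f (val x) <= f (val y) -> x = y.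
  move=> x y E; have [xp|xp] := eqVneq x p.
    by subst x; apply/eqP; apply: contraTT isT => py;
       have := @slope_p y; rewrite eq_sym py E ltxx => /(_ isT).
  have [xq|xq] := eqVneq x q.
    by subst x; apply/eqP; apply: contraTT isT => qy;
       have := @slope_q y; rewrite eq_sym qy E ltxx => /(_ isT).
  have [yp|yp] := eqVneq y p; first by subst y; have := slope_p xp; rewrite E ltxx.
  have [yq|yq] := eqVneq y q; first by subst y; have := slope_q xq; rewrite E ltxx.
  have [/(slope_le x y xp xq yp yq E)//|yx] := leP (f (val x)) (f (val y)).
  by apply/esym/slope_le => //; apply: ltW.
move=> xp xq yp yq; rewrite !slopeE //.
have fx := f_gt0 xp xq; have fy := f_gt0 yp yq.
have fx0 := lt0r_neq0 fx; have fy0 := lt0r_neq0 fy.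
move=> /eqP; rewrite eqr_div // => /eqP E.
rewrite le_eqVlt => /orP[/eqP fE|fxy].
  apply: val_inj; apply: coord_inj => //; move: E; rewrite fE.
  exact: mulIf.
have dxy : 0 < f (val y) - f (val x) by rewrite subr_gt0.
have h1 := mulr_gt0 aq dxy; have h2 := mulr_gt0 aq fx.
have h3 : a (val p) * (f (val y) - f (val x)) < 0 by rewrite nmulr_rlt0.
have h4 : a (val p) * f (val x) < 0 by rewrite nmulr_rlt0.
exfalso; apply: (@not_in_triangle (val p) (val y) (val q) x) => //;
rewrite /tri_area /wedge ?fp ?fq; lra.
Qed.

(** Counting turns the order of real slopes into the numbering by naturals that the combinatorial
    part works with. *)
Definition arc_pos x : nat := #|[set y | slope y < slope x]%SET|.

Lemma arc_pos_lt x y : (arc_pos x < arc_pos y)%N = (slope x < slope y).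
Proof.
have mono u v : slope u <= slope v -> (arc_pos u <= arc_pos v)%N.
  move=> uv; apply: subset_leq_card; apply/fintype.subsetP => z; rewrite !inE.
  by move=> zu; apply: lt_le_trans uv.
case: (ltP (slope x) (slope y)) => [xy|/mono]; last by rewrite leqNgt => /negPf.
apply: proper_card; apply/properP; split.
  by apply/fintype.subsetP => z; rewrite !inE => zx; apply: lt_trans xy.
by exists x; rewrite !inE ?ltxx.
Qed.

Lemma arc_pos_inj : injective arc_pos.
Proof.
move=> x y E; apply: slope_inj; apply/eqP; rewrite eq_le !leNgt -!arc_pos_lt E.
by rewrite ltnn.
Qed.

Lemma not_q x y : slope x < slope y -> x != q.
Proof.
move=> xy; apply: contraTneq xy => ->; rewrite -leNgt.
by case: eqVneq (@slope_q y) => [->|_ /(_ isT)/ltW].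
Qed.

Lemma not_p x y : slope x < slope y -> y != p.
Proof.
move=> xy; apply: contraTneq xy => ->; rewrite -leNgt.
by case: eqVneq (@slope_p x) => [->|_ /(_ isT)/ltW].
Qed.

(** The pair of [p] and [q] is exceptional: [m] lies on their chord, and the cross product
    vanishes. *)
Lemma cr_gt0 x y : slope x < slope y -> (x != p) || (y != q) -> 0 < cr x y.
Proof.
move=> xy; rewrite /wedge.
have xq := not_q xy; have yp := not_p xy.
have [->/= yq|xp _] := eqVneq x p.
  by rewrite fp mulr0 sub0r oppr_gt0 nmulr_rlt0 // f_gt0.
have fx := f_gt0 xp xq; have [->|yq] := eqVneq y q.
  by rewrite fq mulr0 subr0 mulr_gt0.
have fy := f_gt0 yp yq; move: xy; rewrite !slopeE //.
by rewrite ltr_pdivrMr // mulrAC ltr_pdivlMr // subr_gt0.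
Qed.

Lemma area_pq y : y != p -> y != q -> 0 < area p y q.
Proof.
move=> yp yq; have fy := f_gt0 yp yq; have := mulr_gt0 aq fy.
have : a (val p) * f (val y) < 0 by rewrite nmulr_rlt0.
by rewrite /tri_area /wedge fp fq; lra.
Qed.

(* Otherwise [y] would be interior to the triangle [x], [z], [m]. *)
Lemma area_ge0 x y z : slope x < slope y -> slope y < slope z -> 0 <= area x y z.
Proof.
move=> xy yz; have yq := not_q yz; have yp := not_p xy.
have cxy : 0 < cr x y by apply: cr_gt0 => //; rewrite yq orbT.
have cyz : 0 < cr y z by apply: cr_gt0 => //; rewrite yp.
(* For this pair the triangle with vertex [m] degenerates, but the height of [y] gives the sign
   directly. *)
have [/andP[/eqP-> /eqP->]|xz] := boolP ((x == p) && (z == q)).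
  by apply: ltW; apply: area_pq.
rewrite leNgt; apply/negP => lt0.
have cxz : 0 < cr x z by apply: cr_gt0; [apply: lt_trans yz|rewrite -negb_and].
apply: (@not_in_triangle (val x) (val z) m y) => //;
move: cxy cyz cxz lt0; rewrite /tri_area /wedge ?am ?fm; lra.
Qed.

Definition collinear x y z : bool := area x y z == 0.

(** A collinear triple cannot have the blank side as its chord; the positive value serves as a
    denominator later. *)
Lemma collinear_cr x y z : slope x < slope y -> slope y < slope z ->
  collinear x y z -> 0 < cr x z.
Proof.
move=> xy yz /eqP E; apply: cr_gt0; first exact: lt_trans yz.
rewrite -negb_and; apply/negP => /andP[/eqP xp /eqP zq]; subst x z.
by have := area_pq (not_p xy) (not_q yz); rewrite E ltxx.
Qed.

(** Once [area w x z] is 0, the identity [E] equates a nonnegative and a nonpositive number; since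
    [cr w z] is positive, [area w x y] vanishes. *)
Lemma collinearl w x y z : (arc_pos w < arc_pos x)%N -> (arc_pos x < arc_pos y)%N ->
  (arc_pos y < arc_pos z)%N -> collinear w x z -> collinear w x y.
Proof.
rewrite !arc_pos_lt => wx xy yz L; have xz := lt_trans xy yz.
have cwz := collinear_cr wx xz L.
have cwx : 0 < cr w x by apply: cr_gt0 => //; rewrite (not_q xy) orbT.
have wxy := area_ge0 wx xy; have wyz := area_ge0 (lt_trans wx xy) yz.
have E : cr w z * area w x y = - cr w x * area w y z + area w x z * cr w y.
  by rewrite /tri_area /wedge; ring.
by move: E; rewrite (eqP L) mul0r addr0 /collinear => E; apply/eqP; nra.
Qed.

Lemma collinearr w x y z : (arc_pos w < arc_pos x)%N -> (arc_pos x < arc_pos y)%N ->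
  (arc_pos y < arc_pos z)%N -> collinear w y z -> collinear x y z.
Proof.
rewrite !arc_pos_lt => wx xy yz L; have wy := lt_trans wx xy.
have cwz := collinear_cr wy yz L.
have cyz : 0 < cr y z by apply: cr_gt0 => //; rewrite (not_p xy).
have xyz := area_ge0 xy yz; have wxz := area_ge0 wx (lt_trans xy yz).
have E : cr w z * area x y z = - cr y z * area w x z + area w y z * cr x z.
  by rewrite /tri_area /wedge; ring.
by move: E; rewrite (eqP L) mul0r addr0 /collinear => E; apply/eqP; nra.
Qed.

(** * Crossing blocks and intersecting hulls *)

Local Notation crossing := (crosses arc_pos collinear).

Lemma mem_block_hull B x : x \in B -> block_hull B (val x).
Proof. by move=> xB; apply: sub_Conv; exists x. Qed.

Lemma segment_block_hull B x y t : x \in B -> y \in B -> 0 <= t <= 1 ->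
  block_hull B (t *: val x + (1 - t) *: val y).
Proof. by move=> xB yB t01; apply: Conv_convex => //; apply: mem_block_hull. Qed.

(** On a line avoiding [m], cross products about [m] are proportional to directed lengths, so
    [cr y z / cr x z] is the weight of [x]. *)
Lemma collinear_segment x y z : slope x < slope y -> slope y < slope z ->
  collinear x y z ->
  exists2 t, 0 <= t <= 1 & val y = t *: val x + (1 - t) *: val z.
Proof.
move=> xy yz L; have S0 := collinear_cr xy yz L; have S1 := lt0r_neq0 S0.
have cxy : 0 < cr x y by apply: cr_gt0 => //; rewrite (not_q yz) orbT.
have cyz : 0 < cr y z by apply: cr_gt0 => //; rewrite (not_p xy).
have SE : cr x z = cr y z + cr x y by move/eqP: L; rewrite /tri_area; lra.
have tE : 1 - cr y z / cr x z = cr x y / cr x z.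
  by rewrite -[1](divff S1) -mulrBl SE; congr (_ / _); ring.
exists (cr y z / cr x z).
  apply/andP; split; first by apply: divr_ge0; apply: ltW.
  by rewrite ler_pdivrMr // mul1r SE; lra.
have divSK r r' : r / cr x z * r' * cr x z = r * r' by rewrite mulrAC divfK.
apply: coord_inj; rewrite ?a_aff ?f_aff tE; apply: (mulIf S1);
  by rewrite mulrDl !divSK /wedge; ring.
Qed.

(** The diagonals of a convex quadrilateral meet. The weight of a vertex is the area of the triangle
    on the other three, divided by the area of the quadrilateral; [S] is twice the latter. *)
Lemma chords_meet w x y z : slope w < slope x -> slope x < slope y ->
  slope y < slope z -> exists s t, [/\ 0 <= s <= 1, 0 <= t <= 1 &
    s *: val w + (1 - s) *: val y = t *: val x + (1 - t) *: val z].
Proof.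
move=> wx xy yz; have wy := lt_trans wx xy; have xz := lt_trans xy yz.
have wxy := area_ge0 wx xy; have wyz := area_ge0 wy yz.
have wxz := area_ge0 wx xz; have xyz := area_ge0 xy yz.
have sumE : area x y z + area w x z = area w y z + area w x y.
  by rewrite /tri_area /wedge; ring.
set S := area x y z + area w x z in sumE.
(* A flat quadrilateral: [x] itself lies on the chord from [w] to [y]. *)
have [S0|S_neq0] := eqVneq S 0.
  have L : collinear w x y by apply/eqP; move: sumE; rewrite S0; lra.
  have [t t01 xE] := collinear_segment wx xy L.
  by exists t, 1; rewrite -xE subrr scale0r scale1r addr0 ler01 lexx.
have S_gt0 : 0 < S by rewrite lt0r S_neq0 addr_ge0.
have sE : 1 - area x y z / S = area w x z / S.
  by rewrite -[1](divff S_neq0) -mulrBl; congr (_ / _); rewrite /S; ring.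
have tE : 1 - area w y z / S = area w x y / S.
  by rewrite -[1](divff S_neq0) -mulrBl; congr (_ / _); rewrite sumE; ring.
exists (area x y z / S), (area w y z / S); split.
- apply/andP; split; first by apply: divr_ge0 => //; apply: ltW.
  by rewrite ler_pdivrMr // mul1r /S; lra.
- apply/andP; split; first by apply: divr_ge0 => //; apply: ltW.
  by rewrite ler_pdivrMr // mul1r sumE; lra.
- have divSK r r' : r / S * r' * S = r * r' by rewrite mulrAC divfK.
  apply: coord_inj; rewrite !(a_aff, f_aff) sE tE; apply: (mulIf S_neq0);
  by rewrite !mulrDl !divSK /tri_area /wedge; ring.
Qed.

Lemma crossing_meet B C : crossing B C ->
  block_hull B `&` block_hull C !=set0.
Proof.
move=> /crossesP[u [v [x [[uB vB xC] []]]]]; rewrite !arc_pos_lt => ux xv.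
case=> [L|[y yC]].
  have [t t01 xE] := collinear_segment ux xv L.
  exists (val x); split; last exact: mem_block_hull.
  by rewrite xE; apply: segment_block_hull.
rewrite !arc_pos_lt => -[yu|vy].
  have [s [t [s01 t01 E]]] := chords_meet yu ux xv.
  exists (t *: val u + (1 - t) *: val v); split; first exact: segment_block_hull.
  by rewrite -E; apply: segment_block_hull.
have [s [t [s01 t01 E]]] := chords_meet ux xv vy.
exists (s *: val u + (1 - s) *: val v); split; first exact: segment_block_hull.
by rewrite E; apply: segment_block_hull.
Qed.

Lemma block_hull_separated B C (phi : plane -> R) : affine phi ->
  (forall x, x \in B -> phi (val x) <= 0) ->
  (forall x, x \in C -> 0 < phi (val x)) ->
  block_hull B `&` block_hull C = set0.
Proof.
move=> aff Bphi Cphi; apply: (Conv_separated aff) => _ [x xB ->] /=.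
  exact: Bphi.
exact: Cphi.
Qed.

(** Take the shortest chord of [B] spanning [x]. Minimality keeps [B] outside its open arc, the
    absence of crossings keeps [C] inside it and off the chord, so the line of the chord
    separates. *)
Lemma block_hull_gap B C u v x :
  fintype.disjoint (mem B) (mem C) -> ~~ crossing B C ->
  u \in B -> v \in B -> x \in C ->
  (arc_pos u < arc_pos x)%N -> (arc_pos x < arc_pos v)%N ->
  block_hull B `&` block_hull C = set0.
Proof.
move=> dis ncr uB vB xC ux xv.
have neq b c : b \in B -> c \in C -> arc_pos b != arc_pos c.
  move=> bB cC; rewrite (inj_eq arc_pos_inj); apply: contraTneq cC => <-.
  by rewrite (fintype.disjointFr dis).
pose Q := [pred e : P * P | [&& e.1 \in B, e.2 \in B,
  (arc_pos e.1 < arc_pos x)%N & (arc_pos x < arc_pos e.2)%N]].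
have Quv : Q (u, v) by rewrite /= uB vB ux xv.
have [[u0 v0] /and4P[/= u0B v0B ux0 xv0] uv_min] :=
  @arg_minnP _ (u, v) Q (fun e => arc_pos e.2 - arc_pos e.1)%N Quv.
have B_out w : w \in B -> (arc_pos w <= arc_pos u0)%N \/ (arc_pos v0 <= arc_pos w)%N.
  move=> wB; have wx := neq w x wB xC.
  case: (leqP (arc_pos w) (arc_pos u0)) => [|uw]; [by left|right].
  rewrite leqNgt; apply/negP => wv.
  have [wx'|xw] := ltnP (arc_pos w) (arc_pos x).
    by have := uv_min (w, v0); rewrite /= wB v0B wx' xv0 => /(_ isT); order_lia.
  have {}xw : (arc_pos x < arc_pos w)%N by rewrite ltn_neqAle eq_sym wx.
  by have := uv_min (u0, w); rewrite /= wB u0B ux0 xw => /(_ isT); order_lia.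
have C_in w : w \in C -> (arc_pos u0 < arc_pos w)%N /\ (arc_pos w < arc_pos v0)%N.
  move=> wC; have := neq _ _ u0B wC; have := neq _ _ v0B wC => vw uw.
  suff : ~~ ((arc_pos w < arc_pos u0) || (arc_pos v0 < arc_pos w))%N.
    by rewrite negb_or -!leqNgt => /andP[? ?]; rewrite !ltn_neqAle uw eq_sym vw.
  apply: contra ncr => /orP H; apply/crossesP; exists u0, v0, x.
  by split=> //; split=> //; right; exists w.
apply: (block_hull_separated (phi := fun r => tri_area a f (val u0) r (val v0))).
- exact: area_affine.
- have swap w : (area u0 w v0 = - area w u0 v0) /\ (area u0 w v0 = - area u0 v0 w).
    by split; rewrite /tri_area /wedge; ring.
  have uv0 : slope u0 < slope v0 by rewrite -arc_pos_lt (ltn_trans ux0).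
  move=> w wB; case: (B_out w wB); rewrite leq_eqVlt => /orP[/eqP/arc_pos_inj E|].
  + by rewrite E /tri_area /wedge; lra.
  + by rewrite arc_pos_lt => wu; rewrite (swap w).1 oppr_le0 area_ge0.
  + by rewrite -E /tri_area /wedge; lra.
  + by rewrite arc_pos_lt => vw; rewrite (swap w).2 oppr_le0 area_ge0.
- move=> w wC; have [uw wv] := C_in w wC.
  rewrite lt_neqAle area_ge0 -?arc_pos_lt // andbT eq_sym.
  apply: contra ncr => L; apply/crossesP; exists u0, v0, w.
  by split=> //; split=> //; left.
Qed.

(** The separating line passes through [m] with parameter [slope d], where [d] is the last point of
    [C]. If [d] is [p], the artificial value [- slope_bound] still leaves every other point of [P]
    on the far side. *)
Lemma block_hull_ordered B C b c : b \in B -> c \in C ->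
  (forall x y, x \in C -> y \in B -> (arc_pos x < arc_pos y)%N) ->
  block_hull C `&` block_hull B = set0.
Proof.
move=> bB cC CB; have [d dC d_max] := @arg_maxnP _ c [in C] arc_pos cC.
apply: (block_hull_separated (phi := fun r => a r - slope d * f r)).
- by move=> x y t; rewrite a_aff f_aff; ring.
- move=> x xC; have [->|xp] := eqVneq x p; first by rewrite fp mulr0 subr0 ltW.
  have xq : x != q by apply: (@not_q _ b); rewrite -arc_pos_lt CB.
  have : slope x <= slope d by rewrite leNgt -arc_pos_lt -leqNgt; apply: d_max.
  by rewrite slopeE // ler_pdivrMr ?f_gt0 // subr_le0.
- move=> y yB; have dy := CB d y dC yB; rewrite arc_pos_lt in dy.
  have [->|yq] := eqVneq y q; first by rewrite fq mulr0 subr0.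
  have yp := not_p dy; move: dy; rewrite (slopeE yp yq) ltr_pdivlMr ?f_gt0 //.
  by rewrite subr_gt0.
Qed.

(** Either a point of one block lies between two points of the other, or one block entirely precedes
    the other. *)
Lemma uncrossed_disjoint B C b c : b \in B -> c \in C ->
  fintype.disjoint (mem B) (mem C) ->
  ~~ crossing B C -> ~~ crossing C B -> block_hull B `&` block_hull C = set0.
Proof.
move=> bB cC dis nBC nCB.
have dis' : fintype.disjoint (mem C) (mem B) by rewrite fintype.disjoint_sym.
have neq x y : x \in B -> y \in C -> arc_pos x != arc_pos y.
  move=> xB yC; rewrite (inj_eq arc_pos_inj); apply: contraTneq yC => <-.
  by rewrite (fintype.disjointFr dis).
have [|gapB] := boolP [exists u in B, exists v in B, exists x in C,
    (arc_pos u < arc_pos x < arc_pos v)%N].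
  case/exists_inP=> u uB /exists_inP[v vB /exists_inP[x xC /andP[ux xv]]].
  exact: block_hull_gap dis nBC uB vB xC ux xv.
have [|gapC] := boolP [exists u in C, exists v in C, exists x in B,
    (arc_pos u < arc_pos x < arc_pos v)%N].
  case/exists_inP=> u uC /exists_inP[v vC /exists_inP[x xB /andP[ux xv]]].
  by rewrite setIC; apply: block_hull_gap dis' nCB uC vC xB ux xv.
have {}gapB u v x : u \in B -> v \in B -> x \in C ->
    ~~ (arc_pos u < arc_pos x < arc_pos v)%N.
  move=> uB vB xC; apply: contra gapB => uxv; apply/exists_inP; exists u => //.
  by apply/exists_inP; exists v => //; apply/exists_inP; exists x.
have {}gapC u v x : u \in C -> v \in C -> x \in B ->
    ~~ (arc_pos u < arc_pos x < arc_pos v)%N.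
  move=> uB vB xC; apply: contra gapC => uxv; apply/exists_inP; exists u => //.
  by apply/exists_inP; exists v => //; apply/exists_inP; exists x.
have bc := neq b c bB cC; have [cb|bc'] := ltnP (arc_pos c) (arc_pos b).
  rewrite setIC; apply: (block_hull_ordered bB cC) => x y xC yB.
  have ? := neq y x yB xC; have ? := neq y c yB cC.
  have ? := gapC c x y cC xC yB; have ? := gapB y b c yB bB cC; order_lia.
apply: (block_hull_ordered cC bB) => x y xB yC.
have ? := neq x y xB yC; have ? := neq b y bB yC.
have ? := gapB b x y bB xB yC; have ? := gapC y c b yC cC bB; order_lia.
Qed.

Lemma is_ncpartE pi : is_ncpart pi = ncpart arc_pos collinear [set: P]%SET pi.
Proof.
rewrite /is_ncpart /ncpart; case pA: (finset.partition pi _) => //=.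
have neq0 B : B \in pi -> exists x, x \in B by apply: partition_block_neq0 pA.
apply/asboolP/uncrossedP => [nc B C Bp Cp BC|nc B C Bp Cp BC].
  by apply/negP => /crossing_meet; rewrite (nc B C) // => /set0P/eqP.
have [[x xB] [y yC]] := (neq0 B Bp, neq0 C Cp).
apply: (uncrossed_disjoint xB yC); last by apply: nc; rewrite // eq_sym.
  by case/and3P: pA => _ /finset.trivIsetP tI _; apply: tI.
exact: nc.
Qed.

Lemma scd_is_ncpart :
  scd (@merge_step P) (fun pi => #|pi|) (@is_ncpart R P) #|` P|.+1.
Proof.
apply: (eq_scd (fun pi => esym (is_ncpartE pi))).
rewrite cardfE -cardsT; apply: (scd_ncpart arc_pos_inj collinearl collinearr).
by apply/finset.set0Pn; exists p; rewrite finset.in_setT.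
Qed.

End ConvexArc.

(** * Linear forms and sides of a hull *)

Section DotProduct.
Variable R : realType.
Local Notation plane := 'rV[R]_2.
Implicit Types u v x y : plane.

Lemma dotE u x : dot u x = u 0 0 * x 0 0 + u 0 1 * x 0 1.
Proof.
rewrite /dot big_ord_recl big_ord1; congr (_ + _ * _); congr (_ _ _);
exact/val_inj.
Qed.

Lemma dot_affine u : affine (dot u).
Proof. by move=> x y t; rewrite !dotE !mxE; ring. Qed.

Lemma dotNl u x : dot (- u) x = - dot u x.
Proof. by rewrite !dotE !mxE; ring. Qed.

Lemma dot_continuous u : continuous (dot u).
Proof.
move=> w; have nbhsF : Filter (nbhs w) by exact: (@nbhs_filter plane w).
rewrite (_ : dot u = fun x : plane => u 0 0 * x 0 0 + u 0 1 * x 0 1); last first.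
  by apply/funext => x; rewrite dotE.
have cst (c : R) : (fun=> c) @ w --> c by apply: cvg_cst.
exact: (cvgD (cvgM (cst (u 0 0)) (@coord_continuous R 1 2 0 0 w))
             (cvgM (cst (u 0 1)) (@coord_continuous R 1 2 0 1 w))).
Qed.

Definition perp u : plane := \row_i (if i == 0 then - u 0 1 else u 0 0).

(** [u] and [perp u] form an orthogonal basis; the two products determine each coordinate times the
    squared norm of [u]. *)
Lemma dot_perp_inj u x y : u != 0 ->
  dot u x = dot u y -> dot (perp u) x = dot (perp u) y -> x = y.
Proof.
move=> u0; rewrite !dotE !mxE /= => E1 E2.
have N0 : u 0 0 ^+ 2 + u 0 1 ^+ 2 != 0.
  rewrite paddr_eq0 ?sqr_ge0 // !sqrf_eq0; apply: contra u0 => /andP[/eqP u00 /eqP u01].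
  apply/eqP/rowP => i; rewrite mxE.
  by case: (unliftP 0 i) => [j ->|->//]; rewrite (_ : lift 0 j = 1) //;
     apply/val_inj; rewrite /= (ord1 j).
apply/rowP => i; apply: (mulfI N0).
case: (unliftP 0 i) => [j ->|->].
  rewrite (_ : lift 0 j = 1); last by apply/val_inj; rewrite /= (ord1 j).
  have -> z : (u 0 0 ^+ 2 + u 0 1 ^+ 2) * z 0 1 =
    u 0 1 * (u 0 0 * z 0 0 + u 0 1 * z 0 1) + u 0 0 * (- u 0 1 * z 0 0 + u 0 0 * z 0 1).
    by ring.
  by rewrite E1 E2; ring.
have E z : (u 0 0 ^+ 2 + u 0 1 ^+ 2) * z 0 0 =
    u 0 0 * (u 0 0 * z 0 0 + u 0 1 * z 0 1) - u 0 1 * (- u 0 1 * z 0 0 + u 0 0 * z 0 1).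
  by ring.
by rewrite !E E1 E2.
Qed.

End DotProduct.

Section Sides.
Variable R : realType.
Local Notation plane := 'rV[R]_2.
Implicit Types (A K : set plane) (p q x y : plane).

Lemma dot_segment p q (u : plane) (t : R) :
  dot u ((1 - t) *: p + t *: q) = (1 - t) * dot u p + t * dot u q.
Proof. by rewrite !dotE !mxE; ring. Qed.

Lemma segmentC p q : segment p q = segment q p.
Proof.
apply/seteqP; split=> _ [t /andP[t0 t1] <-]; exists (1 - t);
by rewrite ?subKr 1?addrC //=; apply/andP; split; lra.
Qed.

Lemma segment_left p q : segment p q p.
Proof. by exists 0; rewrite /= ?lexx ?ler01 // subr0 scale1r scale0r addr0. Qed.

Lemma segment_right p q : segment p q q.
Proof. by rewrite segmentC; apply: segment_left. Qed.

Lemma is_sideC K p q : is_side K p q -> is_side K q p.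
Proof.
move=> [pq [u [c [u0 Ku E]]]]; split; first by rewrite eq_sym.
by exists u, c; rewrite segmentC.
Qed.

(* [p] is an extreme point of the hull, so the hull minus [p] is convex. *)
Lemma side_endpoint A p q : is_side (Conv A) p q -> A p.
Proof.
move=> [pq [u [c [u0 Ku E]]]]; apply: contrapT => Ap.
have [Kp up] : (Conv A `&` line u c) p by rewrite E; apply: segment_left.
have [_ uq] : (Conv A `&` line u c) q by rewrite E; apply: segment_right.
have vpq : dot (perp u) p != dot (perp u) q.
  by apply: contra_neq pq => ?; apply: (dot_perp_inj u0); rewrite // up uq.
suff cK : @convex_set R plane (Conv A `\` [set p]).
  have AK : A `<=` Conv A `\` [set p].
    by move=> x Ax; split; [apply: sub_Conv|move=> /= xp; apply: Ap; rewrite -xp].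
  by have [_ /(_ erefl)] := Conv_min cK AK Kp.
apply/convex_setP => x y t t01 [Kx /= xp] [Ky /= yp]; split.
  exact: Conv_convex.
move=> /= xyp; have := dot_affine u x y t; rewrite xyp up.
have ux : dot u x <= c by apply: Ku.
have uy : dot u y <= c by apply: Ku.
have [t0|tn0] := eqVneq t 0.
  by move: xyp yp; rewrite t0 scale0r add0r subr0 scale1r.
have [t1|tn1] := eqVneq t 1.
  by move: xyp xp; rewrite t1 subrr scale0r addr0 scale1r.
have {tn0}t_gt0 : 0 < t by rewrite lt0r tn0; case/andP: t01.
have {tn1}t_lt1 : t < 1 by rewrite lt_neqAle tn1; case/andP: t01.
(* A proper combination attaining the bound [c] forces both [x] and [y] to attain it, hence to lie
   on the side. *)
move=> uxy; have uxc : dot u x = c by nra.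
have uyc : dot u y = c by nra.
have [s /andP[s0 s1] xE] : segment p q x by rewrite -E.
have [r /andP[r0 r1] yE] : segment p q y by rewrite -E.
have := dot_affine (perp u) x y t; rewrite xyp -xE -yE !dot_segment => vE.
(* The positions [s] and [r] along the side average to 0, the position of [p]; being nonnegative,
   they vanish. *)
have : (t * s + (1 - t) * r) * (dot (perp u) q - dot (perp u) p) = 0 by lra.
move/eqP; rewrite mulf_eq0 subr_eq0 [_ == dot _ p]eq_sym (negPf vpq) orbF.
have t1_gt0 : 0 < 1 - t by rewrite subr_gt0.
rewrite paddr_eq0 ?mulr_ge0 ?(ltW t_gt0) ?(ltW t1_gt0) // mulf_eq0 gt_eqF //=.
by move=> /andP[/eqP sE _]; apply: xp; rewrite -xE sE subr0 scale1r scale0r addr0.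
Qed.

End Sides.

(** * From lists of merge steps to chains of the poset *)

Section Transfer.
Variables (R : realType) (P : {fset 'rV[R]_2}).

(** The number of blocks drops strictly along the order, and a drop of one leaves no room in
    between. *)
Lemma merge_step_covers (x y : NC P) : merge_step (val x) (val y) -> covers x y.
Proof.
have pP (z : NC P) : finset.partition (val z) [set: P]%SET.
  by case: z => z /= /andP[].
have lt_card (z w : NC P) : (z < w)%O -> (#|val w| < #|val z|)%N.
  rewrite lt_neqAle => /andP[zw lezw]; rewrite ltnNge; apply: contra zw => le_card.
  by apply/eqP/val_inj; apply: refine_card (pP z) (pP w) lezw le_card.
move=> /andP[r /eqP card_xy]; apply/andP; split.
  rewrite lt_neqAle; apply/andP; split; last exact: r.
  by apply/eqP => E; move: card_xy; rewrite E; lia.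
apply/forallP => z; apply/negP => /andP[/lt_card xz /lt_card zy].
by move: xz zy; rewrite card_xy => ? ?; lia.
Qed.

Lemma uniq_flatten_eq (T : eqType) (cs : seq (seq T)) c c' x :
  uniq (flatten cs) -> c \in cs -> c' \in cs -> x \in c -> x \in c' -> c = c'.
Proof.
elim: cs => //= d cs IH; rewrite cat_uniq => /and3P[_ /hasPn dis u].
have out e : e \in cs -> x \in e -> x \notin d.
  by move=> ecs xe; apply: dis; apply/flattenP; exists e.
rewrite !inE => /predU1P[->|ccs] /predU1P[->|c'cs] // xc xc'.
- by have := out _ c'cs xc'; rewrite xc.
- by have := out _ ccs xc; rewrite xc'.
- exact: IH.
Qed.

Lemma seq_NC_val (c : seq {set {set P}}) : all (@is_ncpart R P) c ->
  exists s : seq (NC P), map val s = c.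
Proof.
elim: c => [|x c IH] /=; first by exists [::].
by move=> /andP[ncx /IH[s <-]]; exists (NCPart ncx :: s).
Qed.

(** Block numbers with sum [n + 1] give ranks with sum [2n - (n + 1) = n - 1]. Both numbers are
    positive, hence at most [n], so the truncated subtraction in [nc_rank] is exact. *)
Lemma symmetric_chain_decomposition_scd : (0 < #|` P|)%N ->
  scd (@merge_step P) (fun pi => #|pi|) (@is_ncpart R P) #|` P|.+1 ->
  exists D : {set {set NC P}},
    symmetric_chain_decomposition (@nc_rank R P) (#|` P| - 1) D.
Proof.
move=> P_gt0 [cs [ucs csE csm]].
pose g (c : seq {set {set P}}) := [set z : NC P | val z \in c]%SET.
exists [set S in map g cs]%SET.
have ncc c x : c \in cs -> x \in c -> is_ncpart x.
  move=> ccs xc; have : x \in flatten cs by apply/flattenP; exists c.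
  by rewrite csE.
split.
  apply: partitionI.
  - move=> z _; have : val z \in flatten cs by rewrite csE; apply: (valP z).
    case/flattenP=> c ccs zc; exists (g c); last by rewrite inE.
    by rewrite inE map_f.
  - by move=> B _; apply: finset.subsetT.
  - move=> B; rewrite inE => /mapP[c ccs ->].
    have /allP/(_ c ccs) := csm; case: c ccs => // x s ccs _.
    have ncx := ncc _ _ ccs (mem_head _ _).
    by exists (NCPart ncx); rewrite inE mem_head.
  - move=> B C z; rewrite !inE => /mapP[c ccs ->] /mapP[c' c'cs ->].
    by rewrite !inE => zc zc'; rewrite (uniq_flatten_eq ucs ccs c'cs zc zc').
move=> C; rewrite inE => /mapP[c ccs ->].
have allc : all (@is_ncpart R P) c by apply/allP => x; apply: ncc.
have [[|x s] sE] := seq_NC_val allc.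
  by have /allP/(_ c ccs) := csm; rewrite -sE.
have /allP/(_ c ccs) := csm; rewrite -sE /= path_map last_map.
move=> /andP[pxs /eqP rk]; exists x, s; split.
- by apply/finset.setP => z; rewrite !finset.in_set; apply: (mem_map val_inj (x :: s)).
- by apply: sub_path pxs => y z; apply: merge_step_covers.
have card_gt0 (z : NC P) : (0 < #|val z|)%N.
  have /fset0Pn[y yP] : P != fset0 by rewrite -cardfs_gt0.
  have pP : finset.partition (val z) [set: P]%SET by case: (z) => w /= /andP[].
  have [B Bz _] := partition_blockE pP (finset.in_setT [` yP]%fset).
  by apply/card_gt0P; exists B.
have := card_gt0 x; have := card_gt0 (last x s); rewrite /nc_rank.
by move: rk => /=; lia.
Qed.

End Transfer.

Theorem theorem2p7 (R : realType) (n : nat) (P : {fset 'rV[R]_2})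
    (cardP : #|` P| = n) (hullP : hull_configuration P)
    (polyP : hull_is_polygon P) (blankP : exists p q, blank_side P p q) :
  exists D : {set {set NC P}},
    symmetric_chain_decomposition (@nc_rank R P) (n - 1) D.
Proof.
have no_int x : x \in P -> ~ interior (Conv [set` P]) x.
  by case: hullP => [/polyP|]; last exact.
have [p [q [side_pq blank_pq]]] := blankP.
have pP : p \in P by exact: side_endpoint side_pq.
have qP : q \in P by exact: (side_endpoint (is_sideC side_pq)).
have [pq [u [c [u0 Ku sideE]]]] := side_pq.
have [Kp up] : (Conv [set` P] `&` line u c) p by rewrite sideE; apply: segment_left.
have [Kq uq] : (Conv [set` P] `&` line u c) q by rewrite sideE; apply: segment_right.
(* A form along the side: [perp u] or its opposite, chosen so that [p] comes before [q]. *)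
have [v v_inj vpq] : exists2 v, (forall x y, dot u x = dot u y ->
    dot v x = dot v y -> x = y) & dot v p < dot v q.
  have := dot_perp_inj u0; set w := perp u => w_inj.
  have [wpq|wqp|wE] := ltgtP (dot w p) (dot w q); first by exists w.
    exists (- w); last by rewrite !dotNl ltrN2.
    by move=> x y ux; rewrite !dotNl => /oppr_inj; apply: w_inj.
  by case/eqP: pq; apply: w_inj => //; rewrite up uq.
(* The shift puts the origin at the midpoint of the side, which gives [p] and [q] opposite signs. *)
pose a x := dot v x - (dot v p + dot v q) / 2.
pose f x := c - dot u x.
have a_aff : affine a by move=> x y t; rewrite /a dot_affine; ring.
have f_aff : affine f by move=> x y t; rewrite /f dot_affine; ring.
have a_cont : continuous a.
  move=> x; have nbhsF : Filter (nbhs x) by exact: (@nbhs_filter 'rV[R]_2 x).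
  by apply: cvgB; [apply: dot_continuous|apply: cvg_cst].
have f_cont : continuous f.
  move=> x; have nbhsF : Filter (nbhs x) by exact: (@nbhs_filter 'rV[R]_2 x).
  by apply: cvgB; [apply: cvg_cst|apply: dot_continuous].
have coord_inj x y : a x = a y -> f x = f y -> x = y.
  by rewrite /a /f => ? ?; apply: v_inj; lra.
pose p' : P := [` pP]%fset; pose q' : P := [` qP]%fset.
have fp : f (val p') = 0 by rewrite /f up subrr.
have fq : f (val q') = 0 by rewrite /f uq subrr.
have ap : a (val p') < 0 by rewrite /a /=; lra.
have aq : 0 < a (val q') by rewrite /a /=; lra.
have f_gt0 (x : P) : x != p' -> x != q' -> 0 < f (val x).
  move=> xp xq; have Kx : Conv [set` P] (val x) by apply: sub_Conv; apply: (valP x).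
  rewrite subr_gt0 lt_neqAle (Ku _ Kx) andbT; apply/eqP => ux.
  have : segment p q (val x) by rewrite -sideE.
  case/(blank_pq _ (valP x)) => E; [move: xp|move: xq];
  by rewrite -val_eqE /= E eqxx.
pose m := (1 / 2) *: p + (1 - 1 / 2) *: q.
have am : a m = 0 by rewrite /m a_aff /a; lra.
have fm : f m = 0 by rewrite /m f_aff fp fq; lra.
have mP : Conv [set` P] m by apply: Conv_convex => //; lra.
rewrite -cardP; apply: symmetric_chain_decomposition_scd.
  by rewrite cardfs_gt0; apply/fset0Pn; exists p.
exact: (scd_is_ncpart a_aff f_aff a_cont f_cont coord_inj fp fq ap aq f_gt0
  am fm mP (fun x => no_int _ (valP x))).
Qed.
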